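(* Let $\hat{\Sigma}$ be the stochastic Galerkin system $\hat{E}\dot{\hat{v}}=\hat{A}\hat{v}+\hat{B}u$, $\hat{w}=\hat{C}\hat{v}$, of state dimension $mn$, and let $\sigma_1\ge\sigma_2\ge\cdots\ge\sigma_{mn}$ be its Hankel singular values. For $j=1,\ldots,q$ let $\hat{\Sigma}_j$ be the system $\hat{E}\dot{\hat{v}}=\hat{A}\hat{v}+\hat{B}u$, $\hat{z}_j=\hat{C}_j\hat{v}$, and let $\tilde{\Sigma}_j$ be its reduced-order model of dimension $r<mn$ obtained with the projection matrices of balanced truncation of the complete system $\hat{\Sigma}$ (all as defined in the context). Define $\hat{\eta}_j=\|\hat{\Sigma}_j\|_{\rm H}$, $\hat{\theta}_j=\|\hat{\Sigma}_j\|_{\mathcal{L}^2}$, $\tilde{\eta}_j=\|\tilde{\Sigma}_j\|_{\rm H}$, $\tilde{\theta}_j=\|\tilde{\Sigma}_j\|_{\mathcal{L}^2}$, where $\|\cdot\|_{\rm H}$ is the Hankel norm and $\|\cdot\|_{\mathcal{L}^2}$ the $\mathcal{L}^2$ input-output system norm. Then $$\max\left\{ |\hat{\eta}_j-\tilde{\eta}_j| ,\; |\hat{\theta}_j-\tilde{\theta}_j| \right\} \le 2\sum_{k=r+1}^{mn}\sigma_k$$ uniformly for all $j=1,\ldots,q$.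
   Context: Parametric system: for $p\in\Pi\subseteq\mathbb{R}^q$ consider $E(p)\dot{x}(t,p)=A(p)x(t,p)+B(p)u(t)$, $y(t,p)=C(p)x(t,p)$, $t\ge0$, with $A(p),E(p)\in\mathbb{R}^{n\times n}$, $B(p)\in\mathbb{R}^{n\times n_{\rm in}}$, $C(p)\in\mathbb{R}^{1\times n}$ depending continuously on $p$, $E(p)$ non-singular, and asymptotically stable for each $p$ (all $\lambda\in\mathbb{C}$ with $\det(\lambda E(p)-A(p))=0$ have negative real part). The parameters are independent random variables with joint probability density $\rho$ on $\Pi$; $\mathbb{E}[f]=\int_\Pi f(p)\rho(p)\,{\rm d}p$ (componentwise for matrices), and $\mathcal{L}^2(\Pi)$ has inner product $\langle f,g\rangle=\mathbb{E}[fg]$. Polynomial basis: $(\Phi_i)_{i\in\mathbb{N}}$ is a complete orthonormal system of $\mathcal{L}^2(\Pi)$ consisting of multivariate polynomials that are products of univariate orthonormal polynomials in $p_1,\ldots,p_q$, ordered such that the total degree satisfies ${\rm degree}(\Phi_i)\le{\rm degree}(\Phi_{i+1})$. For a fixed $d$ let $\mathcal{I}^d=\{i\in\mathbb{N}:{\rm degree}(\Phi_i)\le d\}=\{1,\ldots,m\}$, $m=|\mathcal{I}^d|$, and $\mathcal{I}_j^d=\{i\in\mathcal{I}^d:\Phi_i\text{ is non-constant in }p_j\}$ for $j=1,\ldots,q$. Stochastic Galerkin system $\hat{\Sigma}$: with $S(p)=(\Phi_i(p)\Phi_k(p))_{i,k=1,\ldots,m}$ and $s(p)=(\Phi_i(p))_{i=1,\ldots,m}$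 (column vector), set $\hat{A}=\mathbb{E}[S\otimes A]$, $\hat{E}=\mathbb{E}[S\otimes E]\in\mathbb{R}^{mn\times mn}$, $\hat{B}=\mathbb{E}[s\otimes B]\in\mathbb{R}^{mn\times n_{\rm in}}$, $\hat{C}=\mathbb{E}[S\otimes C]\in\mathbb{R}^{m\times mn}$. The system is $\hat{E}\dot{\hat{v}}(t)=\hat{A}\hat{v}(t)+\hat{B}u(t)$, $\hat{w}(t)=\hat{C}\hat{v}(t)$. Standing assumption: it is an asymptotically stable system of ODEs ($\hat{E}$ non-singular, all $\lambda$ with $\det(\lambda\hat{E}-\hat{A})=0$ have negative real part). The matrix $\hat{C}_j\in\mathbb{R}^{k\times mn}$, $k=|\mathcal{I}_j^d|$, consists of those rows of $\hat{C}$ with index in $\mathcal{I}_j^d$. System norms: for a vector-valued function $x$ on an interval $I$, $\|x\|_{\mathcal{L}^2(I)}=\left(\int_I x(t)^\top x(t)\,{\rm d}t\right)^{1/2}$. For a linear system $\Sigma$ with input $u$ and output $w$: (1) the Hankel norm is $\|\Sigma\|_{\rm H}=\sup\{\|w\|_{\mathcal{L}^2([0,\infty))}/\|u\|_{\mathcal{L}^2((-\infty,0])}: u\in\mathcal{L}^2((-\infty,0])^{n_{\rm in}},u\ne0\}$, where $w$ on $[0,\infty)$ is the future output generated by the past input $u$ (state zero at $-\infty$, input zero for $t\ge0$); (2) $\|\Sigma\|_{\mathcal{L}^2}=\sup\{\|w\|_{\mathcal{L}^2([0,\infty))}/\|u\|_{\mathcal{L}^2([0,\infty))}: u\in\mathcal{L}^2([0,\infty))^{n_{\rm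 in}},u\ne0\}$, with zero initial state at $t=0$. Balanced truncation of $\hat{\Sigma}$: let $P,Q$ solve $\hat{A}P\hat{E}^\top+\hat{E}P\hat{A}^\top+\hat{B}\hat{B}^\top=0$ and $\hat{A}^\top Q\hat{E}+\hat{E}^\top Q\hat{A}+\hat{C}^\top\hat{C}=0$, with symmetric decompositions $P=L_PL_P^\top$, $Q=L_QL_Q^\top$. Take the singular value decomposition $U_{\rm l}\,{\rm diag}(\sigma_1,\ldots,\sigma_{mn})\,U_{\rm r}^\top=L_Q^\top\hat{E}L_P$ with $U_{\rm l},U_{\rm r}$ orthogonal and $\sigma_1\ge\cdots\ge\sigma_{mn}$; the $\sigma_k$ are the Hankel singular values of $\hat{\Sigma}$. For $r<mn$ let $\tilde{S}={\rm diag}(\sigma_1,\ldots,\sigma_r)$ (invertible), let $\tilde{U}_{\rm l},\tilde{U}_{\rm r}$ be the first $r$ columns of $U_{\rm l},U_{\rm r}$, and set $T_{\rm l}=L_Q\tilde{U}_{\rm l}\tilde{S}^{-1/2}$, $T_{\rm r}=L_P\tilde{U}_{\rm r}\tilde{S}^{-1/2}$. The reduced matrices are $\tilde{A}=T_{\rm l}^\top\hat{A}T_{\rm r}$, $\tilde{B}=T_{\rm l}^\top\hat{B}$, $\tilde{E}=T_{\rm l}^\top\hat{E}T_{\rm r}$, and $\tilde{C}_j=\hat{C}_jT_{\rm r}$. The reduced-order model $\tilde{\Sigma}_j$ is $\tilde{E}\dot{\tilde{v}}=\tilde{A}\tilde{v}+\tilde{B}u$, $\tilde{z}_j=\tilde{C}_j\tilde{v}$.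 The reduced mass matrix $\tilde{E}$ is non-singular and the reduced-order models are taken to be asymptotically stable. *)

(* Defs.v *)
From HB Require Import structures.
From mathcomp Require Import all_boot all_order all_algebra.
From mathcomp Require Import all_classical all_reals all_analysis.
From mathcomp Require Import complex mxtens.
From mathcomp Require mpoly.
Import numFieldNormedType.Exports.
Import Order.TTheory GRing.Theory Num.Theory.

Set Implicit Arguments.
Unset Strict Implicit.
Unset Printing Implicit Defensive.

Local Open Scope classical_set_scope.
Local Open Scope ring_scope.

Section LebesgueRq.
Context {R : realType} (n : nat).
Variable m : {sigma_finite_measure set (n.-tuple R) -> \bar R}.

Definition cons_pair (xt : R * n.-tuple R) : n.+1.-tuple R :=
  [tuple of xt.1 :: xt.2].

Definition lebesgue_cons : set (n.+1.-tuple R) -> \bar R :=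
  pushforward (lebesgue_measure \x m)%E cons_pair.

Lemma measurable_cons_pair : measurable_fun setT cons_pair.
Proof. exact: measurable_cons. Qed.

HB.instance Definition _ := Measure.copy lebesgue_cons
  (measure_function_pushforward__canonical__measure_function_Measure (lebesgue_measure \x m)%E
   measurable_cons_pair).

Lemma sigma_finite_lebesgue_cons : sigma_finite setT lebesgue_cons.
Proof.
have /sigma_finiteP[F [FT ndF F_fin]] := sigma_finiteT (@lebesgue_measure R).
have /sigma_finiteP[G [GT ndG G_fin]] := sigma_finiteT m.
pose uncons (t : n.+1.-tuple R) := (thead t, [tuple of behead t]).
have muncons : measurable_fun setT uncons.
  by apply/measurable_fun_pairP; split;
    [exact: measurable_tnth|exact: measurable_behead].
exists (fun k => uncons @^-1` (F k `*` G k)).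
  rewrite -preimage_bigcup (_ : \bigcup_k _ = setT) ?preimage_setT//.
  apply/seteqP; split=> // -[x t] _.
  have [i _ Fix] : (\bigcup_i F i) x by rewrite -FT.
  have [j _ Gjt] : (\bigcup_i G i) t by rewrite -GT.
  exists (maxn i j) => //; split.
    by move: Fix; exact/subsetPset/ndF/leq_maxl.
  by move: Gjt; exact/subsetPset/ndG/leq_maxr.
move=> k; have [mFk Fk_fin] := F_fin k; have [mGk Gk_fin] := G_fin k; split.
  by rewrite -[X in measurable X]setTI; apply: muncons => //; exact: measurableX.
rewrite /lebesgue_cons /pushforward -comp_preimage.
rewrite (_ : uncons \o cons_pair = id); last first.
  by apply/funext => -[x t]; congr pair; exact: val_inj.
by rewrite preimage_id product_measure1E// lte_mul_pinfty// ge0_fin_numE.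
Qed.

HB.instance Definition _ :=
  Measure_isSigmaFinite.Build _ _ _ lebesgue_cons sigma_finite_lebesgue_cons.
End LebesgueRq.

(* n-dimensional Lebesgue measure: iterated product of lebesgue_measure. *)
Fixpoint lebesgue_Rn (R : realType) n :
    {sigma_finite_measure set (n.-tuple R) -> \bar R} :=
  match n with
  | 0 => \d_([tuple] : 0.-tuple R)
  | n'.+1 => lebesgue_cons (lebesgue_Rn R n')
  end.

Section Expectation.
Context {R : realType} {q : nat}.
Variables (Pi : set 'rV[R]_q) (rho : 'rV[R]_q -> R).

(* Parameter points are row vectors, for their topology; Lebesgue measure
   lives on tuples, for their product sigma-algebra. *)
Definition row_of_tuple (t : q.-tuple R) : 'rV[R]_q := \row_j tnth t j.

Definition param_measurable (f : 'rV[R]_q -> R) :=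
  measurable_fun (row_of_tuple @^-1` Pi) (f \o row_of_tuple).

(* E[f] = \int_Pi f rho dp; eexpect keeps infinite values. *)
Definition eexpect (f : 'rV[R]_q -> R) : \bar R :=
  (\int[lebesgue_Rn R q]_(t in row_of_tuple @^-1` Pi)
     (f (row_of_tuple t) * rho (row_of_tuple t))%:E)%E.

Definition expect (f : 'rV[R]_q -> R) : R := fine (eexpect f).

Definition expectmx k l (M : 'rV[R]_q -> 'M[R]_(k, l)) : 'M[R]_(k, l) :=
  \matrix_(i, j) expect (fun p => M p i j).

Definition joint_density : Prop :=
  [/\ measurable (row_of_tuple @^-1` Pi),
      param_measurable rho,
      forall p, Pi p -> 0 <= rho p
    & eexpect (fun=> 1) = 1%E].

(* Taking D j = setT for some j gives the product rule for subfamilies. *)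
Definition independent_parameters : Prop :=
  forall D : 'I_q -> set R, (forall j, measurable (D j)) ->
    expect (fun p => \prod_j \1_(D j) (p ord0 j)) =
    \prod_j expect (fun p => \1_(D j) (p ord0 j)).

Definition square_integrable (f : 'rV[R]_q -> R) : Prop :=
  param_measurable f /\ (eexpect (fun p => f p ^+ 2)%R < +oo)%E.

End Expectation.

Section PolynomialBasis.
(* The notations of mpoly clash with those of MathComp-Analysis. *)
Import -(notations) mpoly.
Context {R : realType} {q : nat}.

Definition mpeval (f : mpoly.mpoly q R) (p : 'rV[R]_q) : R :=
  mpoly.meval (fun j => p ord0 j) f.

(* msize is 1 + total degree (and 0 at 0). *)
Definition degree (f : mpoly.mpoly q R) : nat := (mpoly.msize f).-1.

(* Some monomial of f has a positive exponent of X_j. *)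
Definition nonconstant_in (j : 'I_q) (f : mpoly.mpoly q R) : bool :=
  has (fun mon => 0 < mpoly.fun_of_multinom mon j)%N (mpoly.msupp f).

(* f viewed as a polynomial in X_j alone. *)
Definition univariate_in (j : 'I_q) (f : {poly R}) : mpoly.mpoly q R :=
  (map_poly (@mpoly.mpolyC q R) f).[mpoly.mpolyX R (mpoly.mnm1 j)].

(* Indices start at 0. phi j k is the univariate orthonormal polynomial of
   degree k in p_j, and alpha i is the multi-index of Phi i. Completeness: a
   square integrable function orthogonal to all Phi i vanishes in L^2. *)
Definition polynomial_basis (Pi : set 'rV[R]_q) (rho : 'rV[R]_q -> R)
    (Phi : nat -> mpoly.mpoly q R) : Prop :=
  [/\ exists (phi : 'I_q -> nat -> {poly R}) (alpha : nat -> 'I_q -> nat),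
        [/\ forall j k, size (phi j k) = k.+1,
            forall j k l, expect Pi rho (fun p =>
              (phi j k).[p ord0 j] * (phi j l).[p ord0 j]) = (k == l)%:R
          & forall i, Phi i = \prod_j univariate_in j (phi j (alpha i j))],
      forall i k, expect Pi rho (fun p => mpeval (Phi i) p * mpeval (Phi k) p)
        = (i == k)%:R,
      forall f, square_integrable Pi rho f ->
        (forall i, expect Pi rho (fun p => f p * mpeval (Phi i) p) = 0) ->
        eexpect Pi rho (fun p => f p ^+ 2) = 0%E
    & forall i, (degree (Phi i) <= degree (Phi i.+1))%N].

End PolynomialBasis.

Record lti_system (R : realType) (N nin nout : nat) := LtiSystem {
  sysE : 'M[R]_N;
  sysA : 'M[R]_N;
  sysB : 'M[R]_(N, nin);
  sysC : 'M[R]_(nout, N)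
}.

Section Systems.
Context {R : realType}.

Definition asymptotically_stable N (E A : 'M[R]_N) : Prop :=
  E \in unitmx /\
  forall lambda : R[i],
    \det (lambda *: map_mx (real_complex R) E - map_mx (real_complex R) A) = 0 ->
    complex.Re lambda < 0.

Definition L2norm k (I : set R) (x : R -> 'cV[R]_k) : \bar R :=
  sqrte (\int[lebesgue_measure]_(t in I)
           (((x t)^T *m x t) ord0 ord0)%:E)%E.

Definition L2fun k (I : set R) (x : R -> 'cV[R]_k) : Prop :=
  (forall i, measurable_fun I (fun t => x t i ord0)) /\ (L2norm I x < +oo)%E.

(* Caratheodory solution of E v' = A v + B u on the interval I: inputs are only
   square integrable, so the equation is imposed in integrated form. *)
Definition trajectory N nin nout (S : lti_system R N nin nout) (I : set R)
    (u : R -> 'cV[R]_nin) (v : R -> 'cV[R]_N) : Prop :=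
  {within I, continuous v} /\
  forall s t, I s -> I t -> s <= t ->
    sysE S *m (v t - v s) =
    \col_i \int[lebesgue_measure]_(x in `[s, t])
      (sysA S *m v x + sysB S *m u x) i ord0.

Definition past : set R := `]-oo, 0].
Definition future : set R := `[0, +oo[.

(* Both norms are suprema in \bar R over pairs (input, corresponding
   trajectory) with u != 0 in L^2. *)
Definition hankel_norm N nin nout (S : lti_system R N nin nout) : \bar R :=
  ereal_sup [set y | exists u v,
    [/\ L2fun past u,
        L2norm past u != 0%E,
        trajectory S setT (fun t => if t <= 0 then u t else 0) v,
        v t @[t --> -oo] --> (0 : 'cV[R]_N)
      & y = (L2norm future (fun t => sysC S *m v t)
             / L2norm past u)%E]].

Definition L2_system_norm N nin nout (S : lti_system R N nin nout) : \bar R :=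
  ereal_sup [set y | exists u v,
    [/\ L2fun future u,
        L2norm future u != 0%E,
        trajectory S future u v,
        v 0 = 0
      & y = (L2norm future (fun t => sysC S *m v t)
             / L2norm future u)%E]].

Definition restrict_output N nin nout (J : {set 'I_nout})
    (S : lti_system R N nin nout) : lti_system R N nin #|J| :=
  LtiSystem (sysE S) (sysA S) (sysB S)
    (rowsub (fun i : 'I_#|J| => enum_val i) (sysC S)).

Definition project N nin nout r (Tl Tr : 'M[R]_(N, r))
    (S : lti_system R N nin nout) : lti_system R r nin nout :=
  LtiSystem (Tl^T *m sysE S *m Tr) (Tl^T *m sysA S *m Tr)
    (Tl^T *m sysB S) (sysC S *m Tr).

Definition gramians N nin nout (S : lti_system R N nin nout)
    (P Q : 'M[R]_N) : Prop :=
  sysA S *m P *m (sysE S)^T + sysE S *m P *m (sysA S)^T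
    + sysB S *m (sysB S)^T = 0 /\
  (sysA S)^T *m Q *m sysE S + (sysE S)^T *m Q *m sysA S
    + (sysC S)^T *m sysC S = 0.

Definition svd N (Ul : 'M[R]_N) (sigma : 'rV[R]_N) (Ur M : 'M[R]_N) : Prop :=
  [/\ Ul^T *m Ul = 1%:M,
      Ur^T *m Ur = 1%:M,
      forall k, 0 <= sigma ord0 k,
      forall k l : 'I_N, (k <= l)%N -> sigma ord0 l <= sigma ord0 k
    & Ul *m diag_mx sigma *m Ur^T = M].

Section Truncation.
Variables (N r : nat) (lerN : (r <= N)%N).

Definition leading (sigma : 'rV[R]_N) : 'rV[R]_r :=
  colsub (widen_ord lerN) sigma.

(* L U~ S~^(-1/2) with U~ the first r columns of U and S~ = diag(sigma_1..sigma_r). *)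
Definition bt_projection (L U : 'M[R]_N) (sigma : 'rV[R]_N) : 'M[R]_(N, r) :=
  L *m colsub (widen_ord lerN) U
    *m diag_mx (map_mx (fun x => (Num.sqrt x)^-1) (leading sigma)).

End Truncation.
End Systems.

Section StochasticGalerkin.
Context {R : realType} {q n nin : nat}.
Variables (Pi : set 'rV[R]_q) (rho : 'rV[R]_q -> R).
Variables (E A : 'rV[R]_q -> 'M[R]_n).
Variables (B : 'rV[R]_q -> 'M[R]_(n, nin)) (C : 'rV[R]_q -> 'rV[R]_n).
Variables (Phi : nat -> mpoly.mpoly q R) (m : nat).

(* The basis polynomials of degree <= d are Phi 0, ..., Phi m.-1. *)
Definition basis_mx (p : 'rV[R]_q) : 'M[R]_m :=
  \matrix_(i, k) (mpeval (Phi i) p * mpeval (Phi k) p).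

Definition basis_col (p : 'rV[R]_q) : 'cV[R]_m := \col_i mpeval (Phi i) p.

(* The casts identify 'M_(m * n, 1 * nin) with 'M_(m * n, nin) and
   'M_(m * 1, m * n) with 'M_(m, m * n). *)
Definition galerkin : lti_system R (m * n) nin m :=
  LtiSystem
    (expectmx Pi rho (fun p => basis_mx p *t E p))
    (expectmx Pi rho (fun p => basis_mx p *t A p))
    (castmx (erefl, mul1n nin)
       (expectmx Pi rho (fun p => basis_col p *t B p)))
    (castmx (muln1 m, erefl)
       (expectmx Pi rho (fun p => basis_mx p *t C p))).

Definition sensitivity_set (j : 'I_q) : {set 'I_m} :=
  [set i : 'I_m | nonconstant_in j (Phi i)]%SET.

End StochasticGalerkin.

(* Main.v *)
(* Both norms are monotone in the gain from square integrable inputs to outputs, and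
   the Hankel norm involves only inputs supported in the past; so it is enough to
   bound the L^2 norm of the difference of the two outputs, for a common input and
   zero initial states, by 2 (sigma_(r+1) + ... + sigma_N) times the norm of the
   input. Dropping rows of the output matrix only decreases this difference, so the
   bound may be proved for the complete system, whose Gramians are balanced.

   In balanced coordinates with Gramian S, remove one state with singular value
   s > 0. If x and z are the states of the larger and the smaller system, e = x - z
   and f = x + z (z padded by 0), then
     (e^T S e + s^2 f^T S^-1 f)' <= - |C e|^2 + 4 s^2 |u|^2,
   hence the outputs differ by at most 2 s |u|; the contributions of the steps add
   up. Singular values equal to 0 belong to states which are unreachable or
   unobservable and contribute nothing. A quadratic Lyapunov function obtained from
   the Schur form gives finite gains and lets inputs on ]-oo, 0] be replaced by
   inputs supported in ]a, 0]. *)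

Require Import Defs.
From HB Require Import structures.
From mathcomp Require Import all_boot all_order all_algebra.
From mathcomp Require Import all_classical all_reals all_analysis.
From mathcomp Require Import complex mxtens.
From mathcomp Require mpoly.
From mathcomp Require Import measurable_realfun ring lra.
Import numFieldNormedType.Exports.
Import Order.TTheory GRing.Theory Num.Theory.

Set Implicit Arguments.
Unset Strict Implicit.
Unset Printing Implicit Defensive.

Local Open Scope classical_set_scope.
Local Open Scope ring_scope.

(** * Absolutely continuous functions *)

(** Inputs are merely square integrable, so states are only absolutely continuous, and the
    derivative inequalities of the overview are read as statements on increments over compact
    segments, for which a product rule suffices. Removing one state at a time means driving reduced
    systems of intermediate dimensions by the same input; their trajectories have to be constructed,
    and this is what the existence theorem for linear equations is for. Nothing is known about the
    stability of these intermediate systems, which is why the truncation estimates are made on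
    compact segments from zero states. The factor s^2 in the storage function is chosen because S
    and s^2 S^-1 both act as s on the removed state; the 2 in the bound is the coefficient of B u in
    the derivative of f = x + z. The norms themselves are suprema in the extended reals over
    quotients with nonzero inputs. They are replaced by gain inequalities quantified over a real
    constant, and the finiteness obtained from stability is what turns two one-sided comparisons of
    gains into a bound for a difference of norms. *)

Section IntervalIntegrals.
Context {R : realType}.
Notation mu := (@lebesgue_measure R).
Implicit Types (a b c s t : R) (f g F G : R -> R).

Definition integ a b f : Prop := mu.-integrable `[a, b] (EFin \o f).

Lemma integ_sub a b s t f : a <= s -> t <= b -> integ a b f -> integ s t f.
Proof.
move=> as_ tb; apply: integrableS => //.
by apply: subset_itv; rewrite bnd_simp.
Qed.

Lemma integ_eq a b f g :
  (forall x, a <= x -> x <= b -> f x = g x) -> integ a b f -> integ a b g.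
Proof.
move=> fg; apply: eq_integrable => // x.
by rewrite inE/= in_itv/= => /andP[ax xb]; rewrite fg.
Qed.

Lemma integD a b f g : integ a b f -> integ a b g -> integ a b (fun x => f x + g x).
Proof. by move=> fi gi; apply: (integrableD _ fi gi). Qed.

Lemma integZ a b r f : integ a b f -> integ a b (fun x => r * f x).
Proof. by move=> fi; apply: (integrableZl _ r fi). Qed.

Lemma integB a b f g : integ a b f -> integ a b g -> integ a b (fun x => f x - g x).
Proof. by move=> fi gi; apply: (integrableB _ fi gi). Qed.

Lemma integ_cst a b r : integ a b (fun=> r).
Proof.
apply: continuous_compact_integrable; first exact: segment_compact.
exact/continuous_subspaceT/cst_continuous.
Qed.

Lemma integ_sum a b (I : Type) (r : seq I) (f : I -> R -> R) :
  (forall i, integ a b (f i)) -> integ a b (fun x => \sum_(i <- r) f i x).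
Proof.
move=> fi; elim: r => [|i r IH].
  by apply: integ_eq (integ_cst a b 0) => x; rewrite big_nil.
by apply: integ_eq (integD (fi i) IH) => x; rewrite big_cons.
Qed.

Lemma integ_abs a b f : integ a b f -> integ a b (fun x => `|f x|).
Proof. by move=> fi; apply: (integrable_abse fi). Qed.

Lemma integ_continuous a b f : {within `[a, b], continuous f} -> integ a b f.
Proof.
by move=> fc; apply: continuous_compact_integrable => //; exact: segment_compact.
Qed.

Lemma integMl a b f g : {within `[a, b], continuous f} -> integ a b g ->
  integ a b (fun x => f x * g x).
Proof.
move=> fc gi; apply: (integrableMr _ _ _ gi) => //.
  exact: subspace_continuous_measurable_fun.
have /compact_bounded[M [_ mrt]] := continuous_compact fc (@segment_compact _ a b).
by exists M; split; rewrite ?num_real // => ? ? ? ?; exact: mrt.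
Qed.

Definition int_ a b f : R := \int[mu]_(x in `[a, b]) f x.

Lemma int_eq a b f g :
  (forall x, a <= x -> x <= b -> f x = g x) -> int_ a b f = int_ a b g.
Proof.
move=> fg; apply: eq_Rintegral => x.
by rewrite inE/= in_itv/= => /andP[ax xb]; rewrite fg.
Qed.

Lemma intD a b f g : integ a b f -> integ a b g ->
  int_ a b (fun x => f x + g x) = int_ a b f + int_ a b g.
Proof. by move=> fi gi; rewrite /int_ RintegralD. Qed.

Lemma intB a b f g : integ a b f -> integ a b g ->
  int_ a b (fun x => f x - g x) = int_ a b f - int_ a b g.
Proof. by move=> fi gi; rewrite /int_ RintegralB. Qed.

Lemma intZ a b r f : integ a b f ->
  int_ a b (fun x => r * f x) = r * int_ a b f.
Proof. by move=> fi; rewrite /int_ RintegralZl. Qed.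

Lemma measure_segment a b : a <= b -> mu `[a, b]%classic = (b - a)%:E.
Proof.
by move=> ab; rewrite lebesgue_measure_itv/= lte_fin; case: ltgtP ab => // ->; rewrite subrr.
Qed.

Lemma int_cst a b r : a <= b -> int_ a b (fun=> r) = r * (b - a).
Proof.
move=> ab; rewrite /int_ Rintegral_cst//.
by rewrite -[b - a]/(fine (b - a)%:E) -measure_segment.
Qed.

Lemma int_sum a b (I : Type) (r : seq I) (f : I -> R -> R) :
  (forall i, integ a b (f i)) ->
  int_ a b (fun x => \sum_(i <- r) f i x) = \sum_(i <- r) int_ a b (f i).
Proof.
move=> fi; elim: r => [|i r IH].
  rewrite big_nil (@int_eq _ _ _ (fun x => 0 * 0)) => [|x]; last by rewrite big_nil mul0r.
  by rewrite intZ ?mul0r//; exact: integ_cst.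
rewrite big_cons -IH -intD//; last exact: integ_sum.
by apply: int_eq => x; rewrite big_cons.
Qed.

Lemma int_ge0 a b f : (forall x, a <= x -> x <= b -> 0 <= f x) -> 0 <= int_ a b f.
Proof.
by move=> f0; apply: Rintegral_ge0 => x; rewrite /= in_itv/= => /andP[? ?]; apply: f0.
Qed.

Lemma int_le a b f g : integ a b f -> integ a b g ->
  (forall x, a <= x -> x <= b -> f x <= g x) -> int_ a b f <= int_ a b g.
Proof.
move=> fi gi fg; apply: le_Rintegral => // x; rewrite /= in_itv/= => /andP[? ?].
exact: fg.
Qed.

Lemma int_abs a b f : integ a b f -> `|int_ a b f| <= int_ a b (fun x => `|f x|).
Proof. by move=> fi; apply: le_normr_Rintegral. Qed.

Lemma int_cat a b c f : a <= c -> c <= b -> integ a b f ->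
  int_ a b f = int_ a c f + int_ c b f.
Proof.
move=> ac cb fi; have := Rintegral_itvB fi (x := c).
rewrite !bnd_simp => /(_ ac cb) H; rewrite /int_.
rewrite -[X in _ + X]Rintegral_itv_obnd_cbnd; last first.
  apply: integrableS fi => //; apply: subset_itv; rewrite bnd_simp//.
by rewrite -H subrKC.
Qed.

Lemma int_point a f : int_ a a f = 0.
Proof. by rewrite /int_ set_itv1 Rintegral_set1. Qed.

Lemma int_gt a b f : b < a -> int_ a b f = 0.
Proof. by move=> ba; rewrite /int_ set_itv_ge ?bnd_simp -?ltNge// Rintegral_set0. Qed.

Lemma int_mono a b s t f : a <= s -> s <= t -> t <= b -> integ a b f ->
  (forall x, a <= x -> x <= b -> 0 <= f x) -> int_ s t f <= int_ a b f.
Proof.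
move=> as_ st tb fi f0.
rewrite (int_cat as_ (le_trans st tb) fi) (int_cat st tb); last exact: integ_sub fi.
rewrite addrA addrAC lerDr addr_ge0// int_ge0// => x ? ?; apply: f0 => //.
- by rewrite (le_trans _ tb)// (le_trans _ st).
- by rewrite (le_trans as_)// (le_trans st).
Qed.

(** Absolute continuity of the integral, uniform in the position of the short segment. Halving the
    width [d] leaves room for the strict inequality demanded of the measure. *)
Lemma int_small a b f (e : R) : integ a b f -> 0 < e ->
  exists2 d : R, 0 < d & forall s t, a <= s -> s <= t -> t <= b -> t - s <= d ->
    int_ s t (fun x => `|f x|) <= e.
Proof.
move=> fi e0.
have fi' : mu.-integrable setT (EFin \o (f \_ `[a, b])).
  by rewrite -restrict_EFin -integrable_mkcond.
have [d [d0 H]] := integral_normr_continuous fi' e0.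
exists (d / 2) => [|s t as_ st tb std]; first by rewrite divr_gt0.
have -> : int_ s t (fun x => `|f x|) = \int[mu]_(x in `[s, t]) `|(f \_ `[a, b]) x|.
  apply: eq_Rintegral => x; rewrite inE/= in_itv/= => /andP[sx xt].
  rewrite patchE mem_set//= in_itv/= (le_trans as_ sx) /=.
  by rewrite (le_trans xt).
apply/ltW/H => //; have mst := measure_segment st.
apply: (@le_lt_trans _ _ (t - s)%:E); first by rewrite -mst.
by rewrite lte_fin; lra.
Qed.

(** Absolute continuity of [F] with density [f], expressed through increments so that
    differentiation almost everywhere never occurs. *)
Definition primitive a b F f : Prop :=
  [/\ {within `[a, b], continuous F}, integ a b f &
      forall s t, a <= s -> s <= t -> t <= b -> F t - F s = int_ s t f].

Lemma primitive_int a b f r : integ a b f ->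
  primitive a b (fun t => r + int_ a t f) f.
Proof.
move=> fi; split=> //.
- have [ab|ba] := leP a b; last first.
    rewrite set_itv_ge ?bnd_simp -?ltNge//; exact: continuous_subspace0.
  move=> x; apply: cvgD; first exact: cvg_cst.
  exact: (parameterized_integral_continuous ab fi).
- move=> s t as_ st tb; rewrite (int_cat as_ st); last exact: integ_sub fi.
  lra.
Qed.

Lemma primitive_sub a b s t F f : a <= s -> t <= b ->
  primitive a b F f -> primitive s t F f.
Proof.
move=> as_ tb [cF fi Ff]; split; last 2 first.
- exact: integ_sub fi.
- by move=> s' t' ? ? ?; apply: Ff => //; [exact: le_trans as_ _|exact: le_trans tb].
apply: continuous_subspaceW cF; apply: subset_itv; rewrite bnd_simp//.
Qed.

Lemma primitive_eq a b F G f g :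
  (forall x, a <= x -> x <= b -> F x = G x) ->
  (forall x, a <= x -> x <= b -> f x = g x) ->
  primitive a b F f -> primitive a b G g.
Proof.
move=> FG fg [cF fi Ff]; split.
- apply: subspace_eq_continuous cF => x; rewrite inE/= in_itv/= => /andP[? ?].
  exact: FG.
- exact: integ_eq fi.
- move=> s t as_ st tb; rewrite -!FG ?Ff//.
  + apply: int_eq => x ? ?; apply: fg; [exact: le_trans as_ _|exact: le_trans tb].
  + exact: le_trans st tb.
  + exact: le_trans as_ st.
Qed.

Lemma primitive_cst a b r : primitive a b (fun=> r) (fun=> 0).
Proof.
split; [exact/continuous_subspaceT/cst_continuous|exact: integ_cst|].
by move=> s t _ st _; rewrite subrr int_cst// mul0r.
Qed.

Lemma primitiveD a b F G f g : primitive a b F f -> primitive a b G g ->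
  primitive a b (fun x => F x + G x) (fun x => f x + g x).
Proof.
move=> [cF fi Ff] [cG gi Gg]; split.
- by move=> x; apply: cvgD; [exact: cF|exact: cG].
- exact: integD.
- move=> s t as_ st tb; rewrite intD; [|exact: integ_sub fi|exact: integ_sub gi].
  by rewrite -Ff// -Gg//; lra.
Qed.

Lemma primitiveZ a b r F f : primitive a b F f ->
  primitive a b (fun x => r * F x) (fun x => r * f x).
Proof.
move=> [cF fi Ff]; split.
- by move=> x; apply: cvgM; [exact: cvg_cst|exact: cF].
- exact: integZ.
- move=> s t as_ st tb; rewrite intZ; last exact: integ_sub fi.
  by rewrite -Ff// mulrBr.
Qed.

Lemma primitive_sum a b (I : Type) (r : seq I) (F f : I -> R -> R) :
  (forall i, primitive a b (F i) (f i)) ->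
  primitive a b (fun x => \sum_(i <- r) F i x) (fun x => \sum_(i <- r) f i x).
Proof.
move=> Ff; elim: r => [|i r IH].
  by apply: primitive_eq (primitive_cst a b 0) => x; rewrite big_nil.
by apply: primitive_eq (primitiveD (Ff i) IH) => x; rewrite big_cons.
Qed.

(** Both sides are controlled additively: cut [[s, t]] into pieces of length at most [d] and use the
    triangle inequality for the increments of [F]. *)
Lemma increment_local_global a b F g (e d : R) : 0 < d -> integ a b g ->
  (forall s t, a <= s -> s <= t -> t <= b -> t - s <= d ->
    `|F t - F s| <= e * int_ s t g) ->
  forall s t, a <= s -> s <= t -> t <= b -> `|F t - F s| <= e * int_ s t g.
Proof.
move=> d0 gi H s t as_ st tb.
have [n nP] : exists n : nat, t - s <= d *+ n.
  exists (Num.bound ((t - s) / d)); rewrite -mulr_natr mulrC -ler_pdivrMr//.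
  by apply/ltW/archi_boundP; rewrite divr_ge0 ?subr_ge0 ?(ltW d0).
elim: n s as_ st nP => [|n IH] s as_ st nP.
  have -> : s = t by apply/eqP; rewrite eq_le st -subr_le0.
  by rewrite subrr normr0 int_point mulr0.
have [tsd|dts] := leP (t - s) d; first exact: H.
have sd : s <= s + d by rewrite lerDl ltW.
have dt : s + d <= t by lra.
rewrite (int_cat sd dt); last exact: integ_sub gi.
rewrite (_ : F t - F s = (F (s + d) - F s) + (F t - F (s + d))); last lra.
rewrite (le_trans (ler_normD _ _))// mulrDr lerD//.
  by apply: H => //; lra.
by apply: IH => //; rewrite ?mulrS in nP; lra.
Qed.

(* On a short interval F and G oscillate by at most e, so there the increment of
   F G differs from the integral of F g + f G by at most e times the integral of
   |f| + |g|. *)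
Lemma primitiveM a b F G f g : primitive a b F f -> primitive a b G g ->
  primitive a b (fun x => F x * G x) (fun x => F x * g x + f x * G x).
Proof.
move=> pF pG; have [cF fi Ff] := pF; have [cG gi Gg] := pG.
have Fgi : integ a b (fun x => F x * g x) by exact: integMl.
have fGi : integ a b (fun x => f x * G x).
  by apply: integ_eq (integMl cG fi) => x; rewrite mulrC.
split.
- by move=> x; apply: cvgM; [exact: cF|exact: cG].
- exact: integD.
move=> s0 t0 as0 st0 tb0; set h := (X in int_ _ _ X).
have hi : integ a b h by exact: integD.
pose D t := F t * G t - int_ a t h.
pose k x := `|f x| + `|g x|.
have ki : integ a b k by apply: integD; exact: integ_abs.
(* [k] does not depend on [e], so such a bound for every [e] forces the defect [D] of the product
   rule to be constant. *)
suff H : forall e, 0 < e -> forall s t, a <= s -> s <= t -> t <= b ->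
    `|D t - D s| <= e * int_ s t k.
  have k0 : 0 <= int_ s0 t0 k by apply: int_ge0 => *; apply: addr_ge0.
  have : D t0 - D s0 = 0.
    apply/eqP; rewrite -normr_le0; apply/ler_addgt0Pr => e e0; rewrite add0r.
    have e'0 : 0 < e / (int_ s0 t0 k + 1) by rewrite divr_gt0// ltr_wpDl.
    apply: (le_trans (H _ e'0 _ _ as0 st0 tb0)).
    rewrite -mulrA ger_pMr// mulrC ler_pdivrMr ?mul1r; lra.
  rewrite /D (int_cat as0 st0); first lra.
  exact: integ_sub hi.
move=> e e0.
have [d1 d10 H1] := int_small fi e0.
have [d2 d20 H2] := int_small gi e0.
apply: (@increment_local_global _ _ _ _ _ (Num.min d1 d2)) => //.
  by rewrite lt_min d10.
move=> s t as_ st tb; rewrite le_min => /andP[td1 td2].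
have fi' := integ_sub as_ tb fi; have gi' := integ_sub as_ tb gi.
have osc P p : primitive a b P p ->
    int_ s t (fun x => `|p x|) <= e ->
    forall x y, s <= x -> x <= y -> y <= t -> `|P y - P x| <= e.
  move=> [_ pi Pp] pe x y sx xy yt.
  rewrite Pp//; [|exact: le_trans as_ sx|exact: le_trans yt tb].
  apply: (le_trans (int_abs _)).
    by apply: integ_sub pi; [exact: le_trans as_ sx|exact: le_trans yt tb].
  apply: le_trans pe; apply: int_mono => //.
  by apply/integ_abs; exact: integ_sub pi.
have oF := osc _ _ pF (H1 _ _ as_ st tb td1).
have oG := osc _ _ pG (H2 _ _ as_ st tb td2).
have sFg : integ s t (fun x => F s * g x) by exact: integZ.
have tGf : integ s t (fun x => G t * f x) by exact: integZ.
(* Freezing [F] at the left end and [G] at the right end makes the discrete product rule exact: F t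
   G t - F s G s = F s (G t - G s) + G t (F t - F s). *)
have -> : D t - D s = int_ s t (fun x => (F s * g x + G t * f x) - h x).
  rewrite intB; [|exact: integD|exact: integ_sub hi].
  rewrite intD// intZ// intZ// -Ff// -Gg// /D (int_cat as_ st); last exact: integ_sub hi.
  ring.
rewrite -intZ; last exact: integ_sub ki.
have di : integ s t (fun x => (F s * g x + G t * f x) - h x).
  by apply: integB; [exact: integD|exact: integ_sub hi].
apply: (le_trans (int_abs di)); apply: int_le.
- exact: integ_abs.
- by apply: integZ; exact: integ_sub ki.
move=> x sx xt.
rewrite (_ : _ - h x = - ((F x - F s) * g x) + (G t - G x) * f x); last first.
  rewrite /h; ring.
rewrite (le_trans (ler_normD _ _))// normrN !normrM /k mulrDr addrC.
by rewrite lerD// ler_wpM2r// ?oF ?oG.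
Qed.

Lemma primitive_le a b F f g : a <= b -> primitive a b F f -> integ a b g ->
  (forall x, a <= x -> x <= b -> f x <= g x) -> F b - F a <= int_ a b g.
Proof. by move=> ab [_ fi Ff] gi fg; rewrite Ff//; exact: int_le. Qed.

Lemma int_expR a b (l : R) : a <= b -> 0 < l ->
  int_ a b (fun x => expR (l * (x - a))) <= expR (l * (b - a)) / l.
Proof.
rewrite le_eqVlt => /predU1P[<-|ab] l0.
  by rewrite int_point divr_ge0// ?expR_ge0// ltW.
have cE : continuous (fun x => expR (l * (x - a))).
  move=> x; apply: (@continuous_comp _ _ _ (fun x => l * (x - a)) expR).
    apply: cvgM; first exact: cvg_cst.
    by apply: cvgB; [exact: cvg_id|exact: cvg_cst].
  exact: continuous_expR.
have dE (x : R) : is_derive x (1 : R) (fun x : R => expR (l * (x - a)) / l) (expR (l * (x - a))).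
  apply: is_derive_eq; rewrite /GRing.scale/=.
  by rewrite !(mulr0,mulr1,add0r,addr0,subr0,scaler0) mulrC -mulrA mulfV ?mulr1 ?gt_eqF.
have dc (x : R) : {for x, continuous (fun x : R => expR (l * (x - a)) / l)}.
  by apply/differentiable_continuous/derivable1_diffP; have := dE x.
have /(congr1 fine) H : (\int[mu]_(x in `[a, b]) (expR (l * (x - a)))%:E =
    (expR (l * (b - a)) / l)%:E - (expR (l * (a - a)) / l)%:E)%E.
  apply: (@continuous_FTC2 _ _ (fun x => expR (l * (x - a)) / l)) => //.
  - exact: continuous_subspaceT.
  - split=> [x _| |]; first by have := dE x.
      exact/cvg_at_right_filter/dc.
    exact/cvg_at_left_filter/dc.
  - by move=> x _; rewrite derive1E; apply: derive_val.
rewrite /int_ /Rintegral [leLHS]H -EFinB/= gerBl.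
by rewrite divr_ge0// ?expR_ge0// ltW.
Qed.

End IntervalIntegrals.

(** * Inner products and primitives of vector-valued functions *)

Section VectorCalculus.
Context {R : realType}.
Implicit Types (a b s t : R).

(** Written like the integrand of [L2norm], so that the two agree by conversion. *)
Definition dot n (x y : 'cV[R]_n) : R := (x^T *m y) ord0 ord0.

Lemma dotE n (x y : 'cV[R]_n) : dot x y = \sum_i x i ord0 * y i ord0.
Proof. by rewrite /dot mxE; apply: eq_bigr => i _; rewrite mxE. Qed.

Lemma dotC n (x y : 'cV[R]_n) : dot x y = dot y x.
Proof. by rewrite !dotE; apply: eq_bigr => i _; rewrite mulrC. Qed.

Lemma dotDl n (x y z : 'cV[R]_n) : dot (x + y) z = dot x z + dot y z.
Proof. by rewrite /dot linearD/= mulmxDl mxE. Qed.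

Lemma dotDr n (x y z : 'cV[R]_n) : dot z (x + y) = dot z x + dot z y.
Proof. by rewrite /dot mulmxDr mxE. Qed.

Lemma dotZl n r (x y : 'cV[R]_n) : dot (r *: x) y = r * dot x y.
Proof. by rewrite /dot linearZ/= -scalemxAl mxE. Qed.

Lemma dotZr n r (x y : 'cV[R]_n) : dot x (r *: y) = r * dot x y.
Proof. by rewrite dotC dotZl dotC. Qed.

Lemma dotNl n (x y : 'cV[R]_n) : dot (- x) y = - dot x y.
Proof. by rewrite -scaleN1r dotZl mulN1r. Qed.

Lemma dotNr n (x y : 'cV[R]_n) : dot x (- y) = - dot x y.
Proof. by rewrite dotC dotNl dotC. Qed.

Lemma dot0l n (x : 'cV[R]_n) : dot 0 x = 0.
Proof. by rewrite /dot trmx0 mul0mx mxE. Qed.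

Lemma dot0r n (x : 'cV[R]_n) : dot x 0 = 0.
Proof. by rewrite dotC dot0l. Qed.

Lemma dot_mulmx k n (M : 'M[R]_(k, n)) x y : dot (M *m x) y = dot x (M^T *m y).
Proof. by rewrite /dot trmx_mul mulmxA. Qed.

Lemma dot_ge0 n (x : 'cV[R]_n) : 0 <= dot x x.
Proof. by rewrite dotE sumr_ge0// => i _; rewrite -expr2 sqr_ge0. Qed.

Lemma dot_eq0 n (x : 'cV[R]_n) : dot x x = 0 -> x = 0.
Proof.
rewrite dotE => /eqP; rewrite psumr_eq0 => [/allP H|i _]; last by rewrite -expr2 sqr_ge0.
apply/colP => i; rewrite mxE; apply/eqP.
by have := H i (mem_index_enum _); rewrite mulf_eq0 orbb.
Qed.

Lemma sqr_coord_le_dot n (x : 'cV[R]_n) i : x i ord0 ^+ 2 <= dot x x.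
Proof.
rewrite dotE (bigD1 i)//= -expr2 lerDl sumr_ge0// => j _.
by rewrite -expr2 sqr_ge0.
Qed.

Lemma dot_young n (x y : 'cV[R]_n) (r : R) : 0 < r ->
  2 * dot x y <= r * dot x x + r^-1 * dot y y.
Proof.
move=> r0; have := dot_ge0 (r *: x - y).
rewrite !(dotDl,dotDr,dotNl,dotNr,dotZl,dotZr) (dotC y x) => H.
rewrite -subr_ge0 -(pmulr_rge0 _ r0); apply: le_trans H _.
by rewrite le_eqVlt; apply/orP; left; apply/eqP; field; rewrite gt_eqF.
Qed.

(** The constant is the squared Frobenius norm. Each row contributes a Cauchy-Schwarz inequality,
    obtained by expanding the square of (x.x) m - (m.x) x. *)
Lemma dot_mulmx_bound k n (M : 'M[R]_(k, n)) :
  exists2 c : R, 0 <= c & forall x, dot (M *m x) (M *m x) <= c * dot x x.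
Proof.
pose f i := \sum_j M i j ^+ 2.
exists (\sum_i f i) => [|x].
  by apply: sumr_ge0 => i _; apply: sumr_ge0 => j _; exact: sqr_ge0.
rewrite {1}dotE mulr_suml ler_sum// => i _; rewrite -expr2.
pose m := (row i M)^T.
have -> : (M *m x) i ord0 = dot m x.
  by rewrite dotE mxE; apply: eq_bigr => j _; rewrite !mxE.
have -> : f i = dot m m.
  by rewrite dotE; apply: eq_bigr => j _; rewrite !mxE expr2.
have [x0|x0] := eqVneq (dot x x) 0.
  by rewrite (dot_eq0 x0) dot0r expr0n mulr_ge0// dot_ge0.
have {}x0 : 0 < dot x x by rewrite lt_def x0 dot_ge0.
have := dot_ge0 (dot x x *: m - dot m x *: x).
rewrite !(dotDl,dotDr,dotNl,dotNr,dotZl,dotZr) (dotC x m) => H.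
rewrite -subr_ge0 -(pmulr_rge0 _ x0); apply: le_trans H _.
rewrite le_eqVlt; apply/orP; left; apply/eqP; ring.
Qed.

Definition vinteg n a b (x : R -> 'cV[R]_n) :=
  forall i, integ a b (fun t => x t i ord0).

Definition vprim n a b (X x : R -> 'cV[R]_n) :=
  forall i, primitive a b (fun t => X t i ord0) (fun t => x t i ord0).

Lemma vintegD n a b (x y : R -> 'cV[R]_n) : vinteg a b x -> vinteg a b y ->
  vinteg a b (fun t => x t + y t).
Proof. by move=> xi yi i; apply: integ_eq (integD (xi i) (yi i)) => t; rewrite mxE. Qed.

Lemma vintegM k n a b (M : 'M[R]_(k, n)) (x : R -> 'cV[R]_n) : vinteg a b x ->
  vinteg a b (fun t => M *m x t).
Proof.
move=> xi i; apply: integ_eq (integ_sum _ (fun j => integZ (M i j) (xi j))) => t _ _.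
by rewrite mxE.
Qed.

Lemma vprimD n a b (X Y x y : R -> 'cV[R]_n) : vprim a b X x -> vprim a b Y y ->
  vprim a b (fun t => X t + Y t) (fun t => x t + y t).
Proof.
by move=> Xx Yy i; apply: primitive_eq (primitiveD (Xx i) (Yy i)) => t; rewrite mxE.
Qed.

Lemma vprimM k n a b (M : 'M[R]_(k, n)) (X x : R -> 'cV[R]_n) : vprim a b X x ->
  vprim a b (fun t => M *m X t) (fun t => M *m x t).
Proof.
move=> Xx i; apply: primitive_eq (primitive_sum _ (fun j => primitiveZ (M i j) (Xx j)));
  by move=> t _ _; rewrite mxE.
Qed.

Lemma vprim_eq n a b (X Y x y : R -> 'cV[R]_n) :
  (forall t, a <= t -> t <= b -> X t = Y t) ->
  (forall t, a <= t -> t <= b -> x t = y t) ->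
  vprim a b X x -> vprim a b Y y.
Proof.
by move=> XY xy Xx i; apply: primitive_eq (Xx i) => t at_ tb; rewrite ?XY ?xy.
Qed.

Lemma vprimB n a b (X Y x y : R -> 'cV[R]_n) : vprim a b X x -> vprim a b Y y ->
  vprim a b (fun t => X t - Y t) (fun t => x t - y t).
Proof.
by move=> Xx Yy; apply: vprim_eq (vprimD Xx (vprimM (- 1%:M) Yy)) => t _ _;
  rewrite mulNmx mul1mx.
Qed.

Lemma vprim_integ n a b (X x : R -> 'cV[R]_n) : vprim a b X x -> vinteg a b X.
Proof. by move=> Xx i; have [/integ_continuous] := Xx i. Qed.

Lemma primitive_dot n a b (X x Y y : R -> 'cV[R]_n) :
  vprim a b X x -> vprim a b Y y ->
  primitive a b (fun t => dot (X t) (Y t)) (fun t => dot (X t) (y t) + dot (x t) (Y t)).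
Proof.
move=> Xx Yy.
apply: primitive_eq (primitive_sum _ (fun j => primitiveM (Xx j) (Yy j))) => t _ _.
  by rewrite dotE.
by rewrite !dotE -big_split.
Qed.

Lemma primitive_quad n a b (Q : 'M[R]_n) (X x : R -> 'cV[R]_n) : Q^T = Q ->
  vprim a b X x ->
  primitive a b (fun t => dot (X t) (Q *m X t)) (fun t => 2 * dot (X t) (Q *m x t)).
Proof.
move=> QT Xx; apply: primitive_eq (primitive_dot Xx (vprimM Q Xx)) => // t _ _.
rewrite (dotC (x t)) dot_mulmx QT; lra.
Qed.

Lemma integ_dot n a b (X x Y y : R -> 'cV[R]_n) :
  vprim a b X x -> vprim a b Y y -> integ a b (fun t => dot (X t) (Y t)).
Proof. by move=> Xx Yy; have [/integ_continuous] := primitive_dot Xx Yy. Qed.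

End VectorCalculus.

(** * Linear differential equations *)

Section LinearODE.
Context {R : realType}.
Implicit Types (a b s t : R).

Let N n (x : 'cV[R]_n) : R := \sum_i `|x i ord0|.

Let subE n (x y : 'cV[R]_n) i : (x - y) i ord0 = x i ord0 - y i ord0.
Proof. by rewrite !mxE. Qed.

Let N_ge0 n (x : 'cV[R]_n) : 0 <= N x.
Proof. by apply: sumr_ge0. Qed.

Let le_N n (x : 'cV[R]_n) i : `|x i ord0| <= N x.
Proof. by rewrite /N (bigD1 i)//= lerDl sumr_ge0. Qed.

(** Bounds the operator norm of [M] for the sum norm [N]; the summand 1 keeps it positive, since the
    weighted estimates divide by it. *)
Let K n (M : 'M[R]_n) : R := 1 + \sum_i \sum_j `|M i j|.

Let K_gt0 n (M : 'M[R]_n) : 0 < K M.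
Proof. by rewrite ltr_pwDl// sumr_ge0// => i _; rewrite sumr_ge0. Qed.

Let N_mulmx n (M : 'M[R]_n) x : N (M *m x) <= K M * N x.
Proof.
rewrite mulrDl mul1r ler_wpDl ?N_ge0//.
rewrite mulr_suml ler_sum// => i _; rewrite mxE (le_trans (ler_norm_sum _ _ _))//.
by rewrite mulr_suml ler_sum// => j _; rewrite normrM ler_wpM2l// le_N.
Qed.

Let integ_N n a b (x : R -> 'cV[R]_n) : vinteg a b x -> integ a b (fun t => N (x t)).
Proof. by move=> xi; apply: integ_sum => i; exact: integ_abs. Qed.

(* The weight exp (2 K (t - a)) makes a Picard step a contraction on the whole of
   [a, b] instead of on short intervals only. *)
Let picard_step n (M : 'M[R]_n) a b (w w' : R -> 'cV[R]_n) (c : R) :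
  vinteg a b w -> w' a = 0 -> vprim a b w' (fun t => M *m w t) ->
  (forall t, a <= t -> t <= b -> N (w t) <= c * expR (2 * K M * (t - a))) ->
  forall t, a <= t -> t <= b -> N (w' t) <= c / 2 * expR (2 * K M * (t - a)).
Proof.
move=> wi w'a w'P wc t at_ tb.
have K0 := K_gt0 M.
have ei (r : R) : integ a t (fun s => r * expR (2 * K M * (s - a))).
  apply: integ_continuous; apply: continuous_subspaceT => x.
  apply: cvgM; first exact: cvg_cst.
  apply: (@continuous_comp _ _ _ (fun x => 2 * K M * (x - a)) expR).
    apply: cvgM; first exact: cvg_cst.
    by apply: cvgB; [exact: cvg_id|exact: cvg_cst].
  exact: continuous_expR.
have wi' : vinteg a t (fun s => M *m w s).
  by apply: vintegM => i; apply: integ_sub (wi i).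
have -> : w' t = w' t - w' a by rewrite w'a subr0.
apply: (@le_trans _ _ (int_ a t (fun s => N (M *m w s)))).
  rewrite /N int_sum; last by move=> i; apply: integ_abs.
  apply: ler_sum => i _; rewrite !mxE; have [_ _ ->//] := w'P i.
  exact: int_abs.
apply: (@le_trans _ _ (int_ a t (fun s => K M * c * expR (2 * K M * (s - a))))).
  apply: int_le; [exact: integ_N|exact: ei|] => x ax xt.
  apply: (le_trans (N_mulmx _ _)); rewrite -mulrA ler_pM2l//.
  by apply: wc => //; exact: le_trans tb.
have c0 : 0 <= c.
  have := wc a (lexx a) (le_trans at_ tb); rewrite subrr mulr0 expR0 mulr1.
  exact: le_trans.
have ei1 : integ a t (fun s => expR (2 * K M * (s - a))).
  by apply: integ_eq (ei 1) => x; rewrite mul1r.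
rewrite intZ//; apply: (@le_trans _ _ (K M * c * (expR (2 * K M * (t - a)) / (2 * K M)))).
  by rewrite ler_wpM2l ?mulr_ge0// ?(ltW K0)// int_expR// mulr_gt0.
rewrite le_eqVlt; apply/orP; left; apply/eqP; field; rewrite gt_eqF//.
Qed.

Let geo_eq0 (x D : R) : (forall k : nat, `|x| <= D / 2 ^+ k) -> x = 0.
Proof.
move=> H; apply/eqP; rewrite -normr_le0 leNgt; apply/negP => x0.
have D0 : 0 < D.
  by have := lt_le_trans x0 (H 0%N); rewrite expr0 divr1.
have [k kP] : exists k : nat, D / `|x| < k%:R.
  by exists (Num.bound (D / `|x|)); rewrite archi_boundP// divr_ge0// ltW.
have := H k; rewrite ler_pdivlMr ?exprn_gt0// => Hk.
rewrite ltr_pdivrMr// in kP.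
have : (k%:R : R) <= 2 ^+ k by rewrite -natrX ler_nat ltnW// ltn_expl.
move=> k2; have : k%:R * `|x| <= 2 ^+ k * `|x| by rewrite ler_pM2r.
lra.
Qed.

(** [w] is its own Picard iterate, so the contraction can be applied to the same function again and
    again and halves its bound each time. *)
Lemma ode_zero n (M : 'M[R]_n) a b (w : R -> 'cV[R]_n) :
  w a = 0 -> vprim a b w (fun t => M *m w t) ->
  forall t, a <= t -> t <= b -> w t = 0.
Proof.
move=> wa wP t at_ tb.
have wi := vprim_integ wP.
have K0 := K_gt0 M.
pose c := K M * int_ a b (fun s => N (w s)).
have w0 s : a <= s -> s <= b -> N (w s) <= c * expR (2 * K M * (s - a)).
  move=> as_ sb.
  have Mi : vinteg a s (fun s => M *m w s).
    by apply: vintegM => i; apply: integ_sub (wi i).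
  have Ni : integ a s (fun s => N (w s)).
    by apply: integ_N => i; apply: integ_sub (wi i).
  apply: (@le_trans _ _ (int_ a s (fun s => N (M *m w s)))).
    rewrite /N int_sum; last by move=> i; apply: integ_abs.
    rewrite ler_sum// => i _; have [_ _ H] := wP i.
    have -> : w s i ord0 = w s i ord0 - w a i ord0 by rewrite wa mxE subr0.
    by rewrite H//; apply: int_abs.
  apply: (@le_trans _ _ (int_ a s (fun s => K M * N (w s)))).
    by apply: int_le => //; [exact: integ_N|exact: integZ].
  rewrite intZ// -/c; apply: (@le_trans _ _ c).
    by rewrite ler_pM2l// int_mono//; exact: integ_N.
  rewrite ler_peMr//; last by rewrite -expR0 ler_expR mulr_ge0 ?subr_ge0 ?mulr_ge0// ltW.
  by rewrite mulr_ge0 ?(ltW K0)// int_ge0.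
have wk k : forall s, a <= s -> s <= b -> N (w s) <= c / 2 ^+ k * expR (2 * K M * (s - a)).
  elim: k => [|k IH]; first by move=> s; rewrite expr0 divr1; exact: w0.
  move=> s as_ sb; have := picard_step wi wa wP IH as_ sb.
  by rewrite exprSr invfM mulrA.
apply/colP => i; rewrite mxE.
apply: (@geo_eq0 _ (c * expR (2 * K M * (t - a)))) => k.
by rewrite mulrAC; exact: le_trans (le_N _ _) (wk k t at_ tb).
Qed.

(** The segments with centre [u k] and radius 2 c / 2^k, the sum of all later increments, are
    nested; the supremum of their left ends lies in each of them, which gives the limit together
    with its rate. *)
Let geo_lim (u : nat -> R) (c : R) :
  (forall k, `|u k.+1 - u k| <= c / 2 ^+ k) ->
  exists l, forall k, `|l - u k| <= 2 * c / 2 ^+ k.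
Proof.
move=> H; pose A k := u k - 2 * c / 2 ^+ k; pose B k := u k + 2 * c / 2 ^+ k.
have c0 : 0 <= c by have := le_trans (normr_ge0 _) (H 0%N); rewrite expr0 divr1.
have half k : 2 * c / 2 ^+ k.+1 = c / 2 ^+ k.
  by rewrite exprS; field; rewrite expf_neq0.
have dbl k : 2 * c / 2 ^+ k = c / 2 ^+ k + c / 2 ^+ k 
  by field; rewrite expf_neq0.
have Ai k : A k <= A k.+1.
  rewrite /A half dbl; have := H k; rewrite ler_norml => /andP[]; lra.
have Bi k : B k.+1 <= B k.
  rewrite /B half dbl; have := H k; rewrite ler_norml => /andP[]; lra.
have Am j k : (j <= k)%N -> A j <= A k.
  by move=> /subnK<-; elim: (k - j)%N => // i IH; rewrite addSn (le_trans IH).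
have Bm j k : (j <= k)%N -> B k <= B j.
  by move=> /subnK<-; elim: (k - j)%N => // i IH; rewrite addSn (le_trans _ IH).
have AB j k : A j <= B k.
  rewrite (le_trans (Am j _ (leq_maxl j k)))// (le_trans _ (Bm k _ (leq_maxr j k)))//.
  rewrite /A /B lerD2l -subr_ge0 opprK addr_ge0// mulr_ge0 ?mulr_ge0//;
    by rewrite invr_ge0 exprn_ge0.
exists (sup [set A k | k in [set: nat]]) => k.
rewrite ler_distl; apply/andP; split.
  apply: ub_le_sup; last by exists k.
  by exists (B 0%N) => _ [j _ <-].
apply: ge_sup; first by exists (A 0%N); exists 0%N.
by move=> _ [j _ <-]; exact: AB.
Qed.

(** Picard iteration from 0. The iterates are defined on the whole line and their error bound [c t]
    depends on the time reached, so a single limit serves every right end [b]. Before [a] all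
    integrals run over empty segments, hence the solution vanishes there. *)
Theorem ode_exists n (M : 'M[R]_n) a (g : R -> 'cV[R]_n) :
  (forall b, vinteg a b g) ->
  exists v : R -> 'cV[R]_n, (forall t, t <= a -> v t = 0) /\
    forall b, vprim a b v (fun t => M *m v t + g t).
Proof.
move=> gi.
pose step (v : R -> 'cV[R]_n) t : 'cV[R]_n :=
  \col_i int_ a t (fun s => (M *m v s + g s) i ord0).
pose v_ k := iter k step (fun=> 0).
have vi k b : vinteg a b (v_ k) /\ vprim a b (v_ k.+1) (fun t => M *m v_ k t + g t).
  elim: k b => [|k IH] b.
    have v0 : vinteg a b (v_ 0%N).
      by move=> i; apply: integ_eq (integ_cst a b 0) => t; rewrite mxE.
    split=> // i; have Hi : vinteg a b (fun t => M *m v_ 0%N t + g t).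
      exact/vintegD/gi/vintegM.
    by apply: primitive_eq (primitive_int 0 (Hi i)) => t _ _; rewrite ?mxE// add0r.
  have [IH1 IH2] := IH b.
  have v1 := vprim_integ IH2; split=> // i.
  have Hi : vinteg a b (fun t => M *m v_ k.+1 t + g t).
    exact/vintegD/gi/vintegM.
  by apply: primitive_eq (primitive_int 0 (Hi i)) => t _ _; rewrite ?add0r// [RHS]mxE.
have va k t : t <= a -> v_ k t = 0.
  case: k => [//|k] ta; apply/colP => i; rewrite [RHS]mxE [LHS]mxE.
  by move: ta; rewrite le_eqVlt => /orP[/eqP->|ta]; [exact: int_point|exact: int_gt].
pose c t := int_ a t (fun s => N (g s)) * expR (2 * K M * (t - a)).
have inc t k i : `|v_ k.+1 t i ord0 - v_ k t i ord0| <= c t / 2 ^+ k.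
  have [ta|at_] := ltP t a.
    have {}ta := ltW ta; rewrite !va// subrr normr0 divr_ge0 ?exprn_ge0//.
    by rewrite mulr_ge0 ?expR_ge0// int_ge0.
  suff: N (v_ k.+1 t - v_ k t) <= c t / 2 ^+ k.
    by apply: le_trans; rewrite -subE le_N.
  pose c0 := int_ a t (fun s => N (g s)).
  suff H : forall s, a <= s -> s <= t ->
      N (v_ k.+1 s - v_ k s) <= c0 / 2 ^+ k * expR (2 * K M * (s - a)).
    by rewrite /c mulrAC; exact: H.
  have K0 := K_gt0 M.
  elim: k => [|k IH] s as_ st.
    rewrite subr0 expr0 divr1; apply: (@le_trans _ _ c0); last first.
      rewrite ler_peMr//; last by rewrite -expR0 ler_expR mulr_ge0 ?subr_ge0 ?mulr_ge0// ltW.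
      exact: int_ge0.
    apply: (@le_trans _ _ (int_ a s (fun s => N (g s)))).
      rewrite /N int_sum; last by move=> j; apply: integ_abs; exact: gi.
      rewrite ler_sum// => j _; rewrite mxE.
      rewrite (@int_eq _ _ _ _ (fun x => g x j ord0)).
        by apply: int_abs; exact: gi.
      by move=> x _ _; rewrite mulmx0 add0r.
    by apply: int_mono => //; apply: integ_N.
  have := @picard_step _ M a t (fun t => v_ k.+1 t - v_ k t)
    (fun t => v_ k.+2 t - v_ k.+1 t) _ _ _ _ IH s as_ st.
  rewrite exprSr invfM mulrA; apply.
  - move=> j; apply: integ_eq (integB ((vi k.+1 t).1 j) ((vi k t).1 j)) => x.
    by rewrite subE.
  - by rewrite !va// subrr.
  - apply: vprim_eq (vprimB (vi k.+1 t).2 (vi k t).2) => // x _ _.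
    by rewrite mulmxBr addrAC opprD addrA addrAC -!addrA addrCA subrr addr0 addrC.
have [v vP] : exists v : R -> 'cV[R]_n, forall t i k,
    `|v t i ord0 - v_ k t i ord0| <= 2 * c t / 2 ^+ k.
  have /choice[f fP] (ti : R * 'I_n) : exists l, forall k,
      `|l - v_ k ti.1 ti.2 ord0| <= 2 * c ti.1 / 2 ^+ k.
    exact: geo_lim (fun k => inc ti.1 k ti.2).
  by exists (fun t => \col_i f (t, i)) => t i k; rewrite mxE; exact: (fP (t, i)).
exists v; split=> [t ta|b].
  apply/colP => i; rewrite mxE; apply: (@geo_eq0 _ 0) => k.
  have := vP t i k; rewrite va// mxE subr0 /c.
  by move: ta; rewrite le_eqVlt => /orP[/eqP->|ta]; rewrite ?int_point ?int_gt// !(mul0r,mulr0).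
have [ab|ba] := leP a b; last first.
  move=> i; split.
  - rewrite set_itv_ge ?bnd_simp -?ltNge//; exact: continuous_subspace0.
  - rewrite /integ set_itv_ge ?bnd_simp -?ltNge//; exact: integrable_set0.
  - by move=> s t as_ st tb; move: (le_lt_trans (le_trans st tb) ba); rewrite ltNge as_.
have c_ge0 : 0 <= c b by rewrite mulr_ge0 ?expR_ge0// int_ge0.
have {}vP t i k : a <= t -> t <= b ->
    `|v t i ord0 - v_ k t i ord0| <= 2 * c b / 2 ^+ k.
  move=> at_ tb; apply: le_trans (vP t i k) _.
  rewrite ler_wpM2r ?invr_ge0 ?exprn_ge0// ler_wpM2l// ler_pM ?expR_ge0 ?int_ge0//.
    by apply: int_mono => //; exact: integ_N.
  by rewrite ler_expR ler_wpM2l ?lerD2r// mulr_ge0// ltW// K_gt0.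
have vc i : {within `[a, b], continuous (fun t => v t i ord0)}.
  apply/subspace_continuousP => x xab; apply/cvgrPdist_le => e e0.
  have [k kP] : exists k : nat, 8 * c b / 2 ^+ k <= e.
    have [k kP] : exists k : nat, 8 * c b / e < k%:R.
      exists (Num.bound (8 * c b / e)); rewrite archi_boundP// divr_ge0// ?(ltW e0)//.
      by rewrite mulr_ge0.
    exists k; rewrite ler_pdivrMr ?exprn_gt0// (mulrC e) -ler_pdivrMr//.
    by rewrite (le_trans (ltW kP))// -natrX ler_nat ltnW// ltn_expl.
  have [/subspace_continuousP ck _ _] : primitive a b (fun t => v_ k.+1 t i ord0)
    (fun t => (M *m v_ k t + g t) i ord0) by exact: (vi k b).2.
  have /cvgrPdist_le/(_ (e / 2)) := ck x xab.
  rewrite divr_gt0// => /(_ isT) H.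
  have xab2 := xab; move: xab2; rewrite /= in_itv/= => /andP[ax xb].
  have e2 : 2 * c b / 2 ^+ k.+1 <= e / 4.
    rewrite exprS; have := kP; rewrite !invfM => kP'.
    rewrite (_ : 2 * c b * (2^-1 / 2 ^+ k) = 8 * c b / 2 ^+ k / 8);
      last by field; rewrite expf_neq0.
    by rewrite ler_pdivrMr//; apply: le_trans kP _; lra.
  near=> y.
  have yab : y \in `[a, b]%classic by rewrite inE; near: y; exact: withinT.
  move: yab; rewrite inE/= in_itv/= => /andP[ay yb].
  have h1 := le_trans (vP x i k.+1 ax xb) e2.
  have h2 := le_trans (vP y i k.+1 ay yb) e2.
  have h3 : `|v_ k.+1 x i ord0 - v_ k.+1 y i ord0| <= e / 2 by near: y.
  rewrite -[leLHS]/`|v x i ord0 - v y i ord0|.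
  move: h1 h2 h3; rewrite !ler_norml => /andP[? ?] /andP[? ?] /andP[? ?].
  by apply/andP; split; lra.
have vI : vinteg a b v by move=> i; exact: integ_continuous.
have HI : vinteg a b (fun t => M *m v t + g t) by apply/vintegD/gi/vintegM.
move=> i; split => // s t as_ st tb.
set h := (X in int_ _ _ X).
apply/eqP; rewrite -subr_eq0; apply/eqP.
have sb := le_trans st tb; have at_ := le_trans as_ st.
have ts : 0 <= t - s by rewrite subr_ge0.
(* The errors of the iterate at [t] and at [s] cost 2 c each; replacing [v] by [v_ k] under the
   integral costs the remaining term, where n comes from summing the errors of the coordinates in
   [N]. *)
apply: (@geo_eq0 _ (4 * c b + 2 * K M * n%:R * c b * (t - s))) => k.
have h1 := vP t i k.+1 at_ tb.
have h2 := vP s i k.+1 as_ sb.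
have [_ hki h3] : primitive a b (fun t => v_ k.+1 t i ord0)
  (fun t => (M *m v_ k t + g t) i ord0) by exact: (vi k b).2.
have {}h3 := h3 s t as_ st tb.
have h4 : `|int_ s t h - int_ s t (fun t => (M *m v_ k t + g t) i ord0)| <=
    K M * (n%:R * (2 * c b / 2 ^+ k)) * (t - s).
  rewrite -intB; [|exact: integ_sub (HI i)|exact: integ_sub hki].
  apply: (le_trans (int_abs _)).
    by apply: integB; [exact: integ_sub (HI i)|exact: integ_sub hki].
  rewrite -int_cst//; apply: int_le; last 1 first.
  - move=> x sx xt; have ax := le_trans as_ sx; have xb := le_trans xt tb.
    have -> : h x - (M *m v_ k x + g x) i ord0 = (M *m (v x - v_ k x)) i ord0.
      by rewrite /h mulmxBr !mxE; lra.
    rewrite (le_trans (le_N _ _))// (le_trans (N_mulmx _ _))// ler_wpM2l ?(ltW (K_gt0 M))//.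
    rewrite -[n in n%:R]card_ord -sum1_card natr_sum mulr_suml ler_sum// => j _.
    by rewrite mul1r subE; exact: vP.
  - by apply/integ_abs/integB; [exact: integ_sub (HI i)|exact: integ_sub hki].
  - exact: integ_cst.
have e2 : 2 * c b / 2 ^+ k.+1 <= 2 * c b / 2 ^+ k.
  have q0 : 0 <= 2 * c b / 2 ^+ k by rewrite divr_ge0 ?exprn_ge0// mulr_ge0.
  rewrite (_ : 2 * c b / 2 ^+ k.+1 = 2 * c b / 2 ^+ k / 2); first lra.
  by rewrite exprS; field; rewrite expf_neq0.
rewrite (_ : _ / 2 ^+ k = 2 * c b / 2 ^+ k + 2 * c b / 2 ^+ k +
    K M * (n%:R * (2 * c b / 2 ^+ k)) * (t - s)); last first.
  by field; rewrite expf_neq0.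
move: h1 h2 h4; rewrite !ler_norml => /andP[? ?] /andP[? ?] /andP[? ?].
by apply/andP; split; lra.
Unshelve. all: by end_near. Qed.

End LinearODE.

(** * Lyapunov functions of stable matrix pencils *)

Section Lyapunov.
Context {R : realType}.
Local Notation C := R[i].
Let Re := @complex.Re R.
Let Im := @complex.Im R.

Let ReD (x y : C) : Re (x + y) = Re x + Re y. Proof. by case: x y => [? ?] []. Qed.
Let ImD (x y : C) : Im (x + y) = Im x + Im y. Proof. by case: x y => [? ?] []. Qed.

Let Re_sum (I : Type) (r : seq I) (F : I -> C) : Re (\sum_(i <- r) F i) = \sum_(i <- r) Re (F i).
Proof.
by elim: r => [|i r IH]; [rewrite !big_nil|rewrite !big_cons ReD IH].
Qed.

Let Im_sum (I : Type) (r : seq I) (F : I -> C) : Im (\sum_(i <- r) F i) = \sum_(i <- r) Im (F i).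
Proof.
by elim: r => [|i r IH]; [rewrite !big_nil|rewrite !big_cons ImD IH].
Qed.

(** The real inner product of the plane, that is, the real part of conj(z) w. *)
Let p (z w : C) : R := Re z * Re w + Im z * Im w.

Let pDr z w w' : p z (w + w') = p z w + p z w'.
Proof. by rewrite /p ReD ImD; ring. Qed.

Let pM (a z : C) : p z (a * z) = Re a * p z z.
Proof. by rewrite /p /Re /Im; case: a z => [a b] [x y] /=; ring. Qed.

Let p_ge0 z : 0 <= p z z.
Proof. by rewrite addr_ge0 // -expr2 sqr_ge0. Qed.

Let p_young (b z w : C) (e : R) : 0 < e -> p z (b * w) <= e * p z z + (e^-1 * p b b) * p w w.
Proof.
move=> e0; rewrite -subr_ge0 -(pmulr_rge0 _ e0).
rewrite [leRHS](_ : _ = (e * Re z - 2^-1 * Re (b * w)) ^+ 2 + (e * Im z - 2^-1 * Im (b * w)) ^+ 2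
  + 3 / 4 * (p b b * p w w)).
  rewrite !addr_ge0 ?sqr_ge0// mulr_ge0 ?mulr_ge0//; lra.
rewrite /p /Re /Im; case: b z w => [b c] [x y] [u v] /=; field; rewrite gt_eqF//.
Qed.

(* The weight of the first coordinate is chosen last, large enough to absorb its
   coupling to the other ones. *)
Let trig_lyapunov n (T : 'M[C]_n) : is_trig_mx T -> (forall i, Re (T i i) < 0) ->
  exists d : 'I_n -> R, (forall i, 0 <= d i) /\ exists2 e : R, 0 < e &
    forall z : 'cV[C]_n,
      \sum_i d i * p (z i ord0) ((T *m z) i ord0) <= - e * \sum_i p (z i ord0) (z i ord0).
Proof.
elim: n T => [T _ _|n IH T Ttrig Tneg].
  exists (fun=> 0); split=> //; exists 1 => // z.
  by rewrite !big_ord0 mulr0.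
pose T' : 'M[C]_n := \matrix_(i, j) T (lift ord0 i) (lift ord0 j).
have T'trig : is_trig_mx T'.
  by apply/is_trig_mxP => i j ij; rewrite mxE; move/is_trig_mxP: Ttrig; apply.
have [|d' [d'0 [e e0 H]]] := IH T' T'trig; first by move=> i; rewrite mxE.
pose a := T ord0 ord0.
have a0 : Re a < 0 by exact: Tneg.
pose b i := T (lift ord0 i) ord0.
pose D := \sum_i d' i + 1.
have D0 : 0 < D by rewrite ltr_wpDl// sumr_ge0.
(* Weight for Young's inequality: the coupling terms then take at most half of the decay [e] of the
   later coordinates. The 1 in [D] only makes the division legitimate. *)
pose r := e / 2 / D.
have r0 : 0 < r by rewrite !divr_gt0.
pose S := \sum_i d' i * (r^-1 * p (b i) (b i)).
have S0 : 0 <= S.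
  by rewrite sumr_ge0// => i _; rewrite mulr_ge0// mulr_ge0 ?invr_ge0 ?(ltW r0).
(* Chosen so that d0 Re a = - (S + e / 2): [S] pays for the coupling, and e / 2 remains as decay. *)
pose d0 := (S + e / 2) / - Re a.
have d00 : 0 <= d0 by rewrite divr_ge0 ?addr_ge0 ?divr_ge0 ?oppr_ge0 ?(ltW a0) ?(ltW e0).
exists (fun i => if unlift ord0 i is Some j then d' j else d0); split.
  by move=> i; case: (unlift _ _).
exists (e / 2) => [|z]; first by rewrite divr_gt0.
rewrite !big_ord_recl unlift_none.
pose z0 := z ord0 ord0; pose z' : 'cV[C]_n := \col_i z (lift ord0 i) ord0.
have Tz0 : (T *m z) ord0 ord0 = a * z0.
  rewrite mxE big_ord_recl big1 ?addr0// => i _.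
  by move/is_trig_mxP: Ttrig => -> //; rewrite mul0r.
have Tz' i : (T *m z) (lift ord0 i) ord0 = (T' *m z') i ord0 + b i * z0.
  rewrite mxE big_ord_recl addrC; congr (_ + _); rewrite mxE.
  by apply: eq_bigr => j _; rewrite !mxE.
rewrite Tz0 pM -/z0.
have -> : \sum_(i < n) p (z (lift ord0 i) ord0) (z (lift ord0 i) ord0) =
   \sum_i p (z' i ord0) (z' i ord0) by apply: eq_bigr => i _; rewrite mxE.
set Z := \sum_i p (z' i ord0) _.
have H1 : \sum_(i < n) (if unlift ord0 (lift ord0 i) is Some j then d' j else d0) *
    p (z (lift ord0 i) ord0) ((T *m z) (lift ord0 i) ord0) <=
    - e * Z + \sum_i d' i * p (z' i ord0) (b i * z0).
  apply: (@le_trans _ _ (\sum_i (d' i * p (z' i ord0) ((T' *m z') i ord0) +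
     d' i * p (z' i ord0) (b i * z0)))).
    by rewrite ler_sum// => i _; rewrite liftK Tz' pDr mulrDr [z' i ord0]mxE.
  by rewrite big_split/= lerD2r.
have Z0 i : p (z' i ord0) (z' i ord0) <= Z.
  by rewrite /Z (bigD1 i)//= lerDl sumr_ge0.
have H2 : \sum_i d' i * p (z' i ord0) (b i * z0) <= e / 2 * Z + S * p z0 z0.
  apply: (@le_trans _ _ (\sum_i (d' i * (r * Z) + d' i * (r^-1 * p (b i) (b i)) * p z0 z0))).
    rewrite ler_sum// => i _; rewrite -mulrA -mulrDr ler_wpM2l//.
    by apply: (le_trans (p_young _ _ _ r0)); rewrite lerD2r ler_wpM2l ?(ltW r0).
  rewrite big_split/= -!mulr_suml -/S lerD2r mulrA ler_wpM2r ?sumr_ge0//.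
  by rewrite /r mulrC mulrAC ler_pdivrMr// ler_pM2l ?divr_gt0// /D lerDl.
have H3 : d0 * (Re a * p z0 z0) = - (S + e / 2) * p z0 z0.
  by rewrite /d0; field; rewrite lt_eqF.
rewrite H3; have := p_ge0 z0; have : 0 <= Z by rewrite sumr_ge0.
lra.
Qed.

(** Unitary triangularisation carries the weights of [trig_lyapunov] back to the Hermitian form of
    P^* D P. On real vectors this form is that of the real symmetric matrix Pr^T D Pr + Pi^T D Pi,
    and the factor 1 / (2 e) normalises the decay to |x|^2. *)
Lemma lyapunov n (M : 'M[R]_n) :
  (forall l : C, \det (l%:M - map_mx (real_complex R) M) = 0 -> Re l < 0) ->
  exists Y : 'M[R]_n, [/\ Y^T = Y, forall x, 0 <= dot x (Y *m x) &
    forall x, 2 * dot x (Y *m (M *m x)) <= - dot x x].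
Proof.
move=> Mneg; have [n0|n0] := posnP n.
  have z (x y : 'cV[R]_n) : dot x y = 0.
    by rewrite dotE big1// => -[i i_lt] _; exfalso; rewrite n0 in i_lt.
  by exists 0; split=> [|x|x]; rewrite ?trmx0 ?z ?mulr0 ?oppr0.
pose Mc := map_mx (real_complex R) M.
have [P Pu Ptrig] := Schur Mc n0.
have PuV : P *m map_mx Num.conj P^T = 1%:M by apply/unitarymxP.
have PVu : map_mx Num.conj P^T *m P = 1%:M by exact: mulmx1C.
pose T := P *m Mc *m map_mx Num.conj P^T.
have Ttrig : is_trig_mx T.
  by move: Ptrig; rewrite /similar_to conjymx.
have TP : T *m P = P *m Mc by rewrite /T -mulmxA PVu mulmx1.
have Tneg i : Re (T i i) < 0.
  apply: Mneg; set l : C := T i i.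
  have : \det (l%:M - T) = 0.
    rewrite det_trig; last first.
      have /is_trig_mxP Tjk := Ttrig.
      apply/is_trig_mxP => j k jk; rewrite mxE [X in _ + X]mxE Tjk// subr0 mxE.
      by rewrite (_ : (j == k) = false) ?mulr0n//; apply/negbTE; rewrite -val_eqE/= ltn_eqF.
    by rewrite (bigD1 i)//= mxE [X in _ + X]mxE mxE eqxx mulr1n subrr mul0r.
  rewrite (_ : l%:M - T = P *m (l%:M - Mc) *m map_mx Num.conj P^T); last first.
    by rewrite mulmxBr mulmxBl -/T mul_mx_scalar -scalemxAl PuV scalemx1.
  rewrite !det_mulmx => /eqP; rewrite mulrAC -det_mulmx PuV det1 mul1r => /eqP.
  by [].
have [d [d0 [e e0 dP]]] := trig_lyapunov Ttrig Tneg.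
pose Pr := map_mx Re P; pose Pi := map_mx Im P.
pose D := diag_mx (\row_i d i).
pose Y := (2 * e)^-1 *: (Pr^T *m (D *m Pr) + Pi^T *m (D *m Pi)).
have PRe (x : 'cV[R]_n) i : Re ((P *m map_mx (real_complex R) x) i ord0) = (Pr *m x) i ord0.
  rewrite !mxE Re_sum; apply: eq_bigr => j _; rewrite !mxE /Re.
  by case: (P i j) => u v /=; ring.
have PIm (x : 'cV[R]_n) i : Im ((P *m map_mx (real_complex R) x) i ord0) = (Pi *m x) i ord0.
  rewrite !mxE Im_sum; apply: eq_bigr => j _; rewrite !mxE /Im.
  by case: (P i j) => u v /=; ring.
have YE x y : dot x (Y *m y) = (2 * e)^-1 * \sum_i d i *
    p ((P *m map_mx (real_complex R) x) i ord0) ((P *m map_mx (real_complex R) y) i ord0).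
  rewrite /Y -scalemxAl dotZr mulmxDl dotDr; congr (_ * _).
  rewrite -!mulmxA -!dot_mulmx !dotE -big_split/=; apply: eq_bigr => i _.
  rewrite /p !PRe !PIm /D !mul_diag_mx !mxE; ring.
have nx x : \sum_i p ((P *m map_mx (real_complex R) x) i ord0)
    ((P *m map_mx (real_complex R) x) i ord0) = dot x x.
  have PP : Pr^T *m Pr + Pi^T *m Pi = 1%:M.
    apply/matrixP => i j.
    have := congr1 (fun M : 'M[C]_n => Re (M i j)) PVu.
    rewrite !mxE Re_sum -big_split/= => PVu'.
    transitivity (Re (i == j)%:R); last by case: (i == j).
    rewrite -PVu'; apply: eq_bigr => k _; rewrite !mxE /Re.
    rewrite (_ : Num.conj (P k i) = conjc (P k i))//.
    by case: (P k i) (P k j) => [u v] [u' v'] /=; rewrite mulNr opprK.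
  transitivity (dot (Pr *m x) (Pr *m x) + dot (Pi *m x) (Pi *m x)).
    by rewrite !dotE -big_split/=; apply: eq_bigr => i _; rewrite /p PRe PIm.
  by rewrite !dot_mulmx -dotDr !mulmxA -mulmxDl PP mul1mx.
have e2 : 0 < 2 * e by rewrite mulr_gt0.
exists Y; split=> [|x|x].
- rewrite /Y linearZ/= linearD/= !trmx_mul !trmxK -!mulmxA.
  by rewrite (_ : D^T = D)// /D tr_diag_mx.
- rewrite YE mulr_ge0 ?invr_ge0 ?(ltW e2)// sumr_ge0// => i _.
  by rewrite mulr_ge0.
- have := dP (P *m map_mx (real_complex R) x).
  have -> : T *m (P *m map_mx (real_complex R) x) = P *m map_mx (real_complex R) (M *m x).
    by rewrite mulmxA TP -mulmxA -map_mxM.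
  rewrite nx => H.
  rewrite YE; set S := \sum_i _ in H *.
  rewrite (_ : 2 * _ = e^-1 * S); last by field; rewrite gt_eqF.
  by rewrite ler_pdivrMl// mulrN -mulNr.
Qed.

(** det (l E - A) = det E det (l - E^-1 A) reduces the pencil to a single matrix; the form is then
    transported to the variable E x. *)
Lemma stable_lyapunov n (E A : 'M[R]_n) : asymptotically_stable E A ->
  exists Y : 'M[R]_n, [/\ Y^T = Y, forall x, 0 <= dot x (Y *m x) &
    forall x, 2 * dot (E *m x) (Y *m (A *m x)) <= - dot x x].
Proof.
move=> [Eu Aneg].
have [l|Y [YT Y0 YM]] := @lyapunov n (invmx E *m A).
  move=> dl0; apply: Aneg; rewrite -[RHS](mulr0 (\det (map_mx (real_complex R) E))) -dl0.
  rewrite -det_mulmx mulmxBr -map_mxM mulKVmx//; congr (\det (_ - _)).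
  by rewrite mul_mx_scalar.
pose V := invmx E; exists (V^T *m Y *m V); split=> [|x|x].
- by rewrite !trmx_mul trmxK YT mulmxA.
- by rewrite -!mulmxA -dot_mulmx.
- have := YM x; rewrite -!mulmxA -dot_mulmx mulKmx//.
Qed.

End Lyapunov.

(** * Minkowski's inequality with explicit constants *)

Section Minkowski.
Context {R : realType}.
Implicit Types (a b : R).

(** Gains may be enlarged by an arbitrary e > 0. This is used both to divide by constants that could
    vanish and to absorb the error of cutting off an input. *)
Lemma le_sqr_limit (x c U : R) : 0 <= c -> 0 <= U ->
  (forall e, 0 < e -> x <= (c + e) ^+ 2 * U) -> x <= c ^+ 2 * U.
Proof.
move=> c0 U0 H; apply/ler_addgt0Pr => e e0.
pose k := (2 * c + 1) * U + 1.
have k0 : 0 < k by rewrite ltr_wpDl// mulr_ge0// addr_ge0// mulr_ge0.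
pose r := Num.min 1 (e / k).
have r0 : 0 < r by rewrite lt_min ltr01 divr_gt0.
have r1 : r <= 1 by rewrite ge_min lexx.
have rk : r * k <= e by rewrite -ler_pdivlMr// ge_min lexx orbT.
apply: (le_trans (H _ r0)).
have -> : (c + r) ^+ 2 * U = c ^+ 2 * U + r * ((2 * c + r) * U) by ring.
rewrite lerD2l; apply: le_trans rk; rewrite ler_pM2l// /k.
by rewrite (@le_trans _ _ ((2 * c + 1) * U))// ?lerDl// ler_wpM2r// lerD2l.
Qed.

(** Young's inequality with weight d' / c' is optimal here: (1 + d'/c') c'^2 + (1 + c'/d') d'^2 =
    (c' + d')^2. The constants are first enlarged by e / 2 to make them positive. *)
Lemma int_minkowski n a b (f g : R -> 'cV[R]_n) (c d U : R) :
  0 <= c -> 0 <= d -> 0 <= U ->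
  integ a b (fun t => dot (f t) (f t)) -> integ a b (fun t => dot (g t) (g t)) ->
  integ a b (fun t => dot (f t + g t) (f t + g t)) ->
  int_ a b (fun t => dot (f t) (f t)) <= c ^+ 2 * U ->
  int_ a b (fun t => dot (g t) (g t)) <= d ^+ 2 * U ->
  int_ a b (fun t => dot (f t + g t) (f t + g t)) <= (c + d) ^+ 2 * U.
Proof.
move=> c0 d0 U0 fi gi fgi fc gd.
apply: le_sqr_limit => //; first exact: addr_ge0.
move=> e e0; pose c' := c + e / 2; pose d' := d + e / 2.
have c'0 : 0 < c' by rewrite ltr_wpDl// divr_gt0.
have d'0 : 0 < d' by rewrite ltr_wpDl// divr_gt0.
have hi : integ a b (fun t => (1 + d' / c') * dot (f t) (f t) +
    (1 + c' / d') * dot (g t) (g t)) by apply: integD; exact: integZ.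
apply: (le_trans (int_le fgi hi _)) => [t _ _|].
  have /(dot_young (f t) (g t)) : 0 < d' / c' by rewrite divr_gt0.
  by rewrite !(dotDl, dotDr) invf_div (dotC (g t)); lra.
rewrite intD; [|exact: integZ..]; rewrite !intZ//.
have H1 : (1 + d' / c') * int_ a b (fun t => dot (f t) (f t)) <= (1 + d' / c') * (c' ^+ 2 * U).
  rewrite ler_wpM2l//; first by rewrite addr_ge0// divr_ge0// ltW.
  apply: (le_trans fc); rewrite ler_wpM2r// lerXn2r ?nnegrE ?(ltW c'0)//.
  by rewrite lerDl divr_ge0// ltW.
have H2 : (1 + c' / d') * int_ a b (fun t => dot (g t) (g t)) <= (1 + c' / d') * (d' ^+ 2 * U).
  rewrite ler_wpM2l//; first by rewrite addr_ge0// divr_ge0// ltW.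
  apply: (le_trans gd); rewrite ler_wpM2r// lerXn2r ?nnegrE ?(ltW d'0)//.
  by rewrite lerDl divr_ge0// ltW.
apply: (le_trans (lerD H1 H2)); rewrite le_eqVlt; apply/orP; left; apply/eqP.
have -> : c + d + e = c' + d' by rewrite /c' /d'; lra.
by field; rewrite !gt_eqF.
Qed.

End Minkowski.

(** * Rectangular diagonal matrices *)

Section PseudoDiagonal.
Context {R : realType}.

(** The entries come from a sequence on [nat], so that scalings, truncations and embeddings between
    different dimensions belong to one family with one product rule. *)
Definition pdiag_mx m n (f : nat -> R) : 'M[R]_(m, n) :=
  \matrix_(i, j) if i == j :> nat then f i else 0.

Lemma tr_pdiag_mx m n f : (pdiag_mx m n f)^T = pdiag_mx n m f.
Proof. by apply/matrixP => i j; rewrite !mxE eq_sym; case: eqP => // ->. Qed.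

Lemma eq_pdiag_mx m n f g : (forall i, (i < m)%N -> (i < n)%N -> f i = g i) ->
  pdiag_mx m n f = pdiag_mx m n g.
Proof.
move=> fg; apply/matrixP => i j; rewrite !mxE; case: eqP => // ij; apply: fg => //.
by rewrite ij.
Qed.

Lemma mul_pdiag_mx m n p f g :
  pdiag_mx m n f *m pdiag_mx n p g =
  pdiag_mx m p (fun i => if (i < n)%N then f i * g i else 0).
Proof.
apply/matrixP => i j; rewrite !mxE; have [iln|nli] := ltnP i n.
  rewrite (bigD1 (Ordinal iln))//= !mxE eqxx big1 ?addr0 => [|k ki].
    by case: (i == j :> nat); rewrite ?mulr0.
  rewrite !mxE (_ : (i == k :> nat) = false) ?mul0r//.
  by apply/negbTE; apply: contra ki => /eqP ik; apply/eqP/val_inj.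
rewrite big1 ?if_same// => k _; rewrite !mxE (_ : (i == k :> nat) = false) ?mul0r//.
by apply/negbTE; rewrite neq_ltn (leq_trans (ltn_ord k) nli) orbT.
Qed.

Lemma pdiag_mx1 n : pdiag_mx n n (fun=> 1) = 1%:M.
Proof. by apply/matrixP => i j; rewrite !mxE -val_eqE; case: (_ == _). Qed.

Lemma dot_pdiag_ge0 n f (x : 'cV[R]_n) : (forall i, (i < n)%N -> 0 <= f i) ->
  0 <= dot x (pdiag_mx n n f *m x).
Proof.
move=> f0; rewrite dotE sumr_ge0// => i _; rewrite mxE (bigD1 i)//= big1 => [|j ji].
  by rewrite mxE eqxx addr0 mulrCA mulr_ge0// ?f0// -expr2 sqr_ge0.
rewrite !mxE (_ : (i == j :> nat) = false) ?mul0r//.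
by apply/negbTE; apply: contra ji => /eqP ij; apply/eqP/val_inj.
Qed.

End PseudoDiagonal.

(** * Dissipation inequalities *)

Section Dissipation.
Context {R : realType}.
Implicit Types (a b : R).

(* The storage function is e^T S e + s^2 f^T S^-1 f, with e and f the difference
   and the sum of the state and the embedded truncated state: the terms produced
   by the truncation error Delta (A J z + B u) cancel between the two summands. *)
Lemma truncation_step k l nin p (A : 'M[R]_k) (B : 'M[R]_(k, nin))
    (C : 'M[R]_(p, k)) (S Si : 'M[R]_k) (J : 'M[R]_(k, l)) (s a b : R)
    (u : R -> 'cV[R]_nin) (x : R -> 'cV[R]_k) (z : R -> 'cV[R]_l) :
  S^T = S -> Si^T = Si -> (forall x, 0 <= dot x (S *m x)) ->
  (forall x, 0 <= dot x (Si *m x)) -> Si *m S = 1%:M ->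
  A *m S + S *m A^T + B *m B^T = 0 -> A^T *m S + S *m A + C^T *m C = 0 ->
  J^T *m J = 1%:M -> 0 < s -> S *m (1%:M - J *m J^T) = s *: (1%:M - J *m J^T) ->
  a <= b -> x a = 0 -> z a = 0 ->
  vprim a b x (fun t => A *m x t + B *m u t) ->
  vprim a b z (fun t => J^T *m A *m J *m z t + J^T *m B *m u t) ->
  integ a b (fun t => dot (u t) (u t)) ->
  int_ a b (fun t => dot (C *m x t - C *m J *m z t) (C *m x t - C *m J *m z t)) <=
  (2 * s) ^+ 2 * int_ a b (fun t => dot (u t) (u t)).
Proof.
move=> ST SiT S0 Si0 SiS LA LC JJ s0 SD ab xa za xP zP ui.
set De := 1%:M - J *m J^T in SD *.
have DeT : De^T = De by rewrite /De linearB/= trmx1 trmx_mul trmxK.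
have DeJ : De *m J = 0 by rewrite /De mulmxBl mul1mx -mulmxA JJ mulmx1 subrr.
have SSi : S *m Si = 1%:M by exact: mulmx1C.
have SiD : Si *m De = s^-1 *: De.
  have : s^-1 *: (Si *m (S *m De)) = s^-1 *: (Si *m (s *: De)) by rewrite SD.
  rewrite mulmxA SiS mul1mx -scalemxAr scalerA mulVf ?gt_eqF// scale1r.
  by move=> <-.
(* Congruence with S^-1 turns the reachability equation into the dissipation identity for the form
   in [f]. *)
have LB : Si *m A + A^T *m Si + Si *m B *m B^T *m Si = 0.
  have : Si *m (A *m S + S *m A^T + B *m B^T) *m Si = 0 by rewrite LA mulmx0 mul0mx.
  rewrite !mulmxDr !mulmxDl.
  have -> : Si *m (A *m S) *m Si = Si *m A by rewrite -!mulmxA SSi mulmx1.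
  have -> : Si *m (S *m A^T) *m Si = A^T *m Si by rewrite !mulmxA SiS mul1mx.
  by rewrite !mulmxA.
(* The right-hand side of the larger system at the embedded state; the smaller system follows only
   its part outside the range of [De]. *)
pose h t := A *m (J *m z t) + B *m u t.
pose e t := x t - J *m z t; pose f t := x t + J *m z t.
have JzP : vprim a b (fun t => J *m z t) (fun t => h t - De *m h t).
  apply: vprim_eq (vprimM J zP) => // t _ _.
  by rewrite /De mulmxBl mul1mx subKr /h mulmxDr mulmxDr !mulmxA.
have eP : vprim a b e (fun t => A *m e t + De *m h t).
  apply: vprim_eq (vprimB xP JzP) => // t _ _.
  move: (_ *m h t) => V; rewrite /e mulmxBr /h.
  move: (A *m x t) (_ *m (_ *m z t)) (B *m u t) => X Y U.
  by apply/colP => i; rewrite !mxE; ring.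
have fP : vprim a b f (fun t => A *m f t + 2 *: (B *m u t) - De *m h t).
  apply: vprim_eq (vprimD xP JzP) => // t _ _.
  move: (_ *m h t) => V; rewrite /f mulmxDr /h.
  move: (A *m x t) (_ *m (_ *m z t)) (B *m u t) => X Y U.
  by apply/colP => i; rewrite !mxE; ring.
have VP := primitiveD (primitive_quad ST eP) (primitiveZ (s ^+ 2) (primitive_quad SiT fP)).
have ei : integ a b (fun t => dot (C *m e t) (C *m e t)).
  by apply: integ_dot; exact: vprimM eP.
have gi : integ a b (fun t => (2 * s) ^+ 2 * dot (u t) (u t) - dot (C *m e t) (C *m e t)).
  by apply: integB => //; exact: integZ.
have ea : e a = 0 by rewrite /e xa za mulmx0 subr0.
have fa : f a = 0 by rewrite /f xa za mulmx0 addr0.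
have := primitive_le ab VP gi; rewrite ea fa !dot0l mulr0 addr0 subr0 => H.
suff : 0 <= int_ a b (fun t => (2 * s) ^+ 2 * dot (u t) (u t) - dot (C *m e t) (C *m e t)).
  rewrite intB//; last exact: integZ.
  rewrite intZ// subr_ge0; congr (_ <= _); apply: int_eq => t _ _.
  by rewrite /e mulmxBr mulmxA.
apply: le_trans (H _) => [|t _ _].
  by rewrite addr_ge0// mulr_ge0// ?sqr_ge0.
have q1 : 2 * dot (e t) (S *m (A *m e t)) = - dot (C *m e t) (C *m e t).
  have : dot (e t) ((A^T *m S + S *m A + C^T *m C) *m e t) = 0 by rewrite LC mul0mx dot0r.
  rewrite !mulmxDl !dotDr -!mulmxA dot_mulmx.
  rewrite (_ : dot (e t) (A^T *m _) = dot (e t) (S *m (A *m e t))); first lra.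
  by rewrite -dot_mulmx dotC dot_mulmx ST.
pose w := B^T *m (Si *m f t).
have q2 : 2 * dot (f t) (Si *m (A *m f t)) = - dot w w.
  have : dot (f t) ((Si *m A + A^T *m Si + Si *m B *m B^T *m Si) *m f t) = 0.
    by rewrite LB mul0mx dot0r.
  rewrite !mulmxDl !dotDr -!mulmxA.
  rewrite (_ : dot (f t) (A^T *m _) = dot (f t) (Si *m (A *m f t))); last first.
    by rewrite -dot_mulmx dotC dot_mulmx SiT.
  rewrite (_ : dot (f t) (Si *m (B *m _)) = dot w w); first lra.
  by rewrite /w dot_mulmx trmxK dot_mulmx SiT.
(* [De] annihilates the embedded state J z, so [e] and [f] both pair with De h as [x] does. The
   weights are s here and s^2 s^-1 in [q4], with opposite signs. *)
have q3 : dot (e t) (S *m (De *m h t)) = s * dot (x t) (De *m h t).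
  rewrite mulmxA SD -scalemxAl dotZr; congr (_ * _).
  have -> : dot (e t) (De *m h t) = dot (De *m e t) (h t) by rewrite dot_mulmx DeT.
  by rewrite /e mulmxBr mulmxA DeJ mul0mx subr0 dot_mulmx DeT.
have q4 : dot (f t) (Si *m (De *m h t)) = s^-1 * dot (x t) (De *m h t).
  rewrite mulmxA SiD -scalemxAl dotZr; congr (_ * _).
  have -> : dot (f t) (De *m h t) = dot (De *m f t) (h t) by rewrite dot_mulmx DeT.
  by rewrite /f mulmxDr mulmxA DeJ mul0mx addr0 dot_mulmx DeT.
have q5 : dot (f t) (Si *m (B *m u t)) = dot w (u t).
  by rewrite /w dot_mulmx trmxK dot_mulmx SiT.
rewrite [S *m (_ + _)]mulmxDr [Si *m (_ + _)]mulmxDr [Si *m (_ + _)]mulmxDr.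
rewrite [Si *m - _]mulmxN [Si *m (_ *: _)]linearZ/= !dotDr dotNr dotZr q3 q4 q5.
(* What is left of the form in [f] is s^2 (4 w.u - |w|^2); the square of w - 2 u bounds it by (2
   s)^2 |u|^2. *)
have q6 : 0 <= s ^+ 2 * (dot w w + 4 * dot (u t) (u t) - 4 * dot w (u t)).
  rewrite mulr_ge0 ?sqr_ge0//; have := dot_ge0 (w - 2 *: u t).
  by move: (w) => w0; rewrite !(dotDl,dotDr,dotNl,dotNr,dotZl,dotZr) (dotC (u t) w0); lra.
rewrite -subr_ge0; apply: (le_trans q6); rewrite le_eqVlt; apply/orP; left; apply/eqP.
have {}q2 : dot (f t) (Si *m (A *m f t)) = - (dot w w / 2) by lra.
have {}q1 : dot (e t) (S *m (A *m e t)) = - (dot (C *m e t) (C *m e t) / 2) by lra.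
by rewrite q1 q2; field; rewrite gt_eqF.
Qed.

Lemma mulmx_tr_eq0 m n (M : 'M[R]_(m, n)) : M *m M^T = 0 -> M = 0.
Proof.
move=> H; apply/matrixP => i j; rewrite mxE.
have : \sum_k M i k ^+ 2 = 0.
  have := congr1 (fun X : 'M[R]_m => X i i) H; rewrite !mxE => H'; rewrite -[RHS]H'.
  by apply: eq_bigr => k _; rewrite mxE expr2.
move/eqP; rewrite psumr_eq0 => [/allP/(_ j (mem_index_enum _))|k _]; last exact: sqr_ge0.
by rewrite sqrf_eq0 => /eqP.
Qed.

(* The row kernel of E P is stable under A E^-1 and annihilates B. *)
Lemma unreachable_zero n nin m (E A P : 'M[R]_n) (B : 'M[R]_(n, nin))
    (W : 'M[R]_(m, n)) (a b : R) (u : R -> 'cV[R]_nin) (x : R -> 'cV[R]_n) :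
  E \in unitmx -> P^T = P ->
  A *m P *m E^T + E *m P *m A^T + B *m B^T = 0 -> W *m E *m P = 0 ->
  x a = 0 -> vprim a b (fun t => E *m x t) (fun t => A *m x t + B *m u t) ->
  forall t, a <= t -> t <= b -> W *m E *m x t = 0.
Proof.
move=> Eu PT LP WEP xa xP t at_ tb.
pose K := kermx (E *m P).
have KEP : K *m E *m P = 0 by rewrite -mulmxA mulmx_ker.
have Ksub l (X : 'M[R]_(l, n)) : X *m E *m P = 0 -> exists N, X = N *m K.
  by move=> XEP; apply/submxP; apply/sub_kermxP; rewrite mulmxA.
clearbody K.
have PEK : P *m E^T *m K^T = 0.
  by rewrite -{1}PT -!trmx_mul mulmxA KEP trmx0.
(* Between [K] and its transpose only K B (K B)^T survives from the Lyapunov equation. *)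
have KB : K *m B = 0.
  apply: mulmx_tr_eq0.
  have : K *m (A *m P *m E^T + E *m P *m A^T + B *m B^T) *m K^T = 0.
    by rewrite LP mulmx0 mul0mx.
  rewrite !mulmxDr !mulmxDl.
  have -> : K *m (A *m P *m E^T) *m K^T = 0.
    by rewrite -!mulmxA (mulmxA P) PEK !mulmx0.
  have -> : K *m (E *m P *m A^T) *m K^T = 0 by rewrite !mulmxA KEP !mul0mx.
  by rewrite !add0r !mulmxA => H; rewrite trmx_mul !mulmxA.
have KAP : K *m A *m P = 0.
  have : K *m (A *m P *m E^T + E *m P *m A^T + B *m B^T) = 0 by rewrite LP mulmx0.
  rewrite !mulmxDr (mulmxA K B) KB mul0mx addr0.
  have -> : K *m (E *m P *m A^T) = 0 by rewrite !mulmxA KEP mul0mx.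
  rewrite addr0 !mulmxA => H; rewrite -[LHS](@mulmxK _ _ _ E^T) ?unitmx_tr//.
  by rewrite H mul0mx.
have [M MP] : exists M, K *m A *m invmx E = M *m K.
  by apply: Ksub; rewrite mulmxKV// KAP.
have [N NP] := Ksub _ _ WEP.
have KP : vprim a b (fun t => K *m E *m x t) (fun t => M *m (K *m E *m x t)).
  apply: vprim_eq (vprimM K xP) => s _ _; first by rewrite mulmxA.
  rewrite mulmxDr (mulmxA K B) KB mul0mx addr0 [in RHS]mulmxA [M *m _]mulmxA -MP.
  by rewrite mulmxKV// mulmxA.
rewrite NP -!mulmxA (mulmxA K).
by rewrite (ode_zero _ KP) ?mulmx0// xa mulmx0.
Qed.

(** For e = x - Tr z, the form (E e)^T Q (E e) dissipates |C e|^2. The projection error F h pairs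
    with Q E e to h^T W E e, and W E e = 0: for [x] because W E annihilates reachable states, for Tr
    z by hypothesis. *)
Lemma reduction_of_unreachable k n nin p (E A P Q : 'M[R]_n) (B : 'M[R]_(n, nin))
    (C : 'M[R]_(p, n)) (Tl Tr : 'M[R]_(n, k)) (a b : R)
    (u : R -> 'cV[R]_nin) (x : R -> 'cV[R]_n) (z : R -> 'cV[R]_k) :
  E \in unitmx -> P^T = P -> Q^T = Q -> (forall x, 0 <= dot x (Q *m x)) ->
  A *m P *m E^T + E *m P *m A^T + B *m B^T = 0 ->
  A^T *m Q *m E + E^T *m Q *m A + C^T *m C = 0 ->
  (1%:M - Tl *m Tr^T *m E^T) *m Q *m E *m P = 0 ->
  (1%:M - Tl *m Tr^T *m E^T) *m Q *m E *m Tr = 0 ->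
  a <= b -> x a = 0 -> z a = 0 ->
  vprim a b (fun t => E *m x t) (fun t => A *m x t + B *m u t) ->
  vprim a b z (fun t => Tl^T *m A *m Tr *m z t + Tl^T *m B *m u t) ->
  int_ a b (fun t => dot (C *m x t - C *m Tr *m z t) (C *m x t - C *m Tr *m z t)) <= 0.
Proof.
move=> Eu PT QT Q0 LP LQ WP WTr ab xa za xP zP.
set W := (1%:M - _) *m Q in WP WTr.
have Wx := unreachable_zero Eu PT LP WP xa xP.
pose h t := A *m (Tr *m z t) + B *m u t.
pose F := 1%:M - E *m Tr *m Tl^T.
have WT : W = (Q *m F)^T.
  by rewrite /W /F trmx_mul QT linearB/= trmx1 !trmx_mul trmxK mulmxA.
pose e t := x t - Tr *m z t.
have eP : vprim a b (fun t => E *m e t) (fun t => A *m e t + F *m h t).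
  apply: vprim_eq (vprimB xP (vprimM (E *m Tr) zP)) => t _ _.
    by rewrite /e mulmxBr mulmxA.
  have -> : E *m Tr *m (Tl^T *m A *m Tr *m z t + Tl^T *m B *m u t) = h t - F *m h t.
    by rewrite /F mulmxBl mul1mx subKr /h mulmxDr mulmxDr !mulmxA.
  move: (_ *m h t) => V; rewrite /e mulmxBr /h.
  move: (A *m x t) (_ *m (_ *m z t)) (B *m u t) => X Y U.
  by apply/colP => i; rewrite !mxE; ring.
have eP' : vprim a b e (fun t => invmx E *m (A *m e t + F *m h t)).
  by apply: vprim_eq (vprimM (invmx E) eP) => // t _ _; rewrite mulKmx.
have VP := primitive_quad QT eP.
have ei : integ a b (fun t => - dot (C *m e t) (C *m e t)).
  by apply: integ_eq (integZ (-1) (integ_dot (vprimM C eP') (vprimM C eP'))) => t; rewrite mulN1r.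
have := primitive_le ab VP ei; rewrite /e xa za mulmx0 subr0 mulmx0 dot0l subr0 => H.
suff : 0 <= int_ a b (fun t => - dot (C *m e t) (C *m e t)).
  rewrite (_ : int_ _ _ _ = - int_ a b (fun t => dot (C *m e t) (C *m e t))).
    rewrite oppr_ge0; congr (_ <= _); apply: int_eq => t _ _.
    by rewrite /e mulmxBr mulmxA.
  rewrite -mulN1r -intZ; last exact: integ_dot (vprimM C eP') (vprimM C eP').
  by apply: int_eq => t; rewrite mulN1r.
apply: le_trans (H _) => [|t at_ tb]; first exact: Q0.
have -> : dot (E *m e t) (Q *m (A *m e t + F *m h t)) = dot (E *m e t) (Q *m (A *m e t)).
  rewrite mulmxDr dotDr [X in _ + X](_ : _ = 0) ?addr0// dotC mulmxA dot_mulmx -WT.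
  by rewrite mulmxA /e mulmxBr Wx// mulmxA WTr mul0mx subr0 dot0r.
have : dot (e t) ((A^T *m Q *m E + E^T *m Q *m A + C^T *m C) *m e t) = 0.
  by rewrite LQ mul0mx dot0r.
rewrite !mulmxDl !dotDr -!mulmxA -!dot_mulmx (dotC (A *m _)) dot_mulmx QT.
lra.
Qed.

(** The Lyapunov function V satisfies V' <= - |x|^2 + 2 x.(E^T Y B u), and Young's inequality with
    weight 1/2 leaves - |x|^2 / 2 + 2 c |u|^2. Doubling after integration gives the factors 2 and 4
    c. *)
Lemma stable_energy n nin (E A : 'M[R]_n) (B : 'M[R]_(n, nin)) :
  asymptotically_stable E A ->
  exists (Y : 'M[R]_n) (c : R), [/\ 0 <= c, forall x, 0 <= dot x (Y *m x) &
    forall a b u x, a <= b -> integ a b (fun t => dot (u t) (u t)) ->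
      vprim a b (fun t => E *m x t) (fun t => A *m x t + B *m u t) ->
      integ a b (fun t => dot (x t) (x t)) /\
      int_ a b (fun t => dot (x t) (x t)) <=
      2 * dot (E *m x a) (Y *m (E *m x a)) + c * int_ a b (fun t => dot (u t) (u t))].
Proof.
move=> st; have [Y [YT Y0 YP]] := stable_lyapunov st; have [Eu _] := st.
have [c c0 cP] := dot_mulmx_bound (E^T *m Y *m B).
exists Y, (4 * c); split=> //; first by rewrite mulr_ge0.
move=> a b u x ab ui xP.
have xP' : vprim a b x (fun t => invmx E *m (A *m x t + B *m u t)).
  by apply: vprim_eq (vprimM (invmx E) xP) => // t _ _; rewrite mulKmx.
have xi := integ_dot xP' xP'; split=> //.
have gi : integ a b (fun t => 2 * c * dot (u t) (u t) - 2^-1 * dot (x t) (x t)).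
  by apply: integB; exact: integZ.
have := primitive_le ab (primitive_quad YT xP) gi.
rewrite intB; [|exact: integZ..]; rewrite !intZ// => H.
suff /H : forall t, a <= t -> t <= b -> 2 * dot (E *m x t) (Y *m (A *m x t + B *m u t)) <=
    2 * c * dot (u t) (u t) - 2^-1 * dot (x t) (x t).
  have := Y0 (E *m x b); lra.
move=> t _ _; rewrite mulmxDr dotDr mulrDr.
have := YP (x t).
have -> : dot (E *m x t) (Y *m (B *m u t)) = dot (x t) (E^T *m Y *m B *m u t).
  by rewrite dot_mulmx !mulmxA.
have := cP (u t).
have /(dot_young (x t) (E^T *m Y *m B *m u t)) : 0 < 2^-1 :> R by rewrite invr_gt0.
rewrite invrK; lra.
Qed.

End Dissipation.

(** * Balanced truncation *)

Section BalancedTruncation.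

Let tr3 (R : comPzRingType) m n p q (X : 'M[R]_(m, n)) (Y : 'M[R]_(m, p)) (Z : 'M[R]_(p, q)) :
  (X^T *m Y *m Z)^T = Z^T *m Y^T *m X.
Proof. by rewrite !trmx_mul trmxK mulmxA. Qed.

Let tr2 (R : comPzRingType) m n p (X : 'M[R]_(m, n)) (Y : 'M[R]_(p, n)) :
  (X *m Y^T)^T = Y *m X^T.
Proof. by rewrite trmx_mul trmxK. Qed.

Context {R : realType}.
Variables (N nin p : nat) (E A P Q LP LQ Ul Ur : 'M[R]_N) (B : 'M[R]_(N, nin)).
Variables (C : 'M[R]_(p, N)) (sigma : 'rV[R]_N).
Hypothesis Eu : E \in unitmx.
Hypothesis gramP : A *m P *m E^T + E *m P *m A^T + B *m B^T = 0.
Hypothesis gramQ : A^T *m Q *m E + E^T *m Q *m A + C^T *m C = 0.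
Hypotheses (PE : P = LP *m LP^T) (QE : Q = LQ *m LQ^T).
Hypothesis svdM : svd Ul sigma Ur (LQ^T *m E *m LP).

(** The singular values as a sequence on [nat], zero from [N] on. Indices start at 0, so [sg k] is
    the value lost in passing from level k + 1 to level k. *)
Let sg (i : nat) : R := if insub i is Some j then sigma ord0 j else 0.

Let sgE (i : 'I_N) : sg i = sigma ord0 i. Proof. by rewrite /sg valK. Qed.

Let sg_ge0 i : 0 <= sg i.
Proof. by rewrite /sg; case: insubP => // j _ _; have [_ _ + _ _] := svdM. Qed.

Let sg_anti i j : (i <= j)%N -> (j < N)%N -> sg j <= sg i.
Proof.
move=> ij jN; have iN := leq_ltn_trans ij jN.
have [_ _ _ H _] := svdM; have := H (Ordinal iN) (Ordinal jN) ij.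
by rewrite -!sgE.
Qed.

Let tail k : R := \sum_(i < N | (k <= i)%N) sigma ord0 i.

Let tail_ge0 k : 0 <= tail k.
Proof. by apply: sumr_ge0 => i _; rewrite -sgE. Qed.

Let tailS k : (k < N)%N -> tail k = sg k + tail k.+1.
Proof.
move=> kN; rewrite /tail (bigD1 (Ordinal kN))//= -sgE; congr (_ + _).
by apply: eq_bigl => i; rewrite ltn_neqAle andbC -val_eqE eq_sym.
Qed.

(** Column selection and scaling by S~^(-1/2) in one matrix, which makes sense at every level k. A
    vanishing singular value gives the entry 0^-1 = 0. *)
Let D k : 'M[R]_(N, k) := pdiag_mx N k (fun i => (Num.sqrt (sg i))^-1).
Let Tl k : 'M[R]_(N, k) := LQ *m Ul *m D k.
Let Tr k : 'M[R]_(N, k) := LP *m Ur *m D k.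
Let S k : 'M[R]_k := pdiag_mx k k sg.

Let bt_projectionE k (le : (k <= N)%N) (L U : 'M[R]_N) :
  bt_projection le L U sigma = L *m U *m D k.
Proof.
rewrite /bt_projection -!mulmxA; congr (_ *m _); apply/matrixP => i j.
rewrite mul_mx_diag [LHS]mxE [RHS]mxE (bigD1 (widen_ord le j))//= big1 => [|l lj].
  by rewrite addr0 !mxE eqxx sgE.
rewrite [X in _ * X]mxE (_ : (l == j :> nat) = false) ?mulr0//.
by apply/negbTE; apply: contra lj => /eqP lj; apply/eqP/val_inj.
Qed.

Let svdE : LQ^T *m E *m LP = Ul *m pdiag_mx N N sg *m Ur^T.
Proof.
have [_ _ _ _ <-] := svdM; congr (_ *m _ *m _); apply/matrixP => i j; rewrite !mxE.
by rewrite -val_eqE sgE; case: (_ == _).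
Qed.

Let PT : P^T = P. Proof. by rewrite PE trmx_mul trmxK. Qed.
Let QT : Q^T = Q. Proof. by rewrite QE trmx_mul trmxK. Qed.

Let Q_ge0 x : 0 <= dot x (Q *m x).
Proof. by rewrite QE -mulmxA -[X in X *m _]trmxK -dot_mulmx dot_ge0. Qed.

Let sqrt_sg i : 0 < sg i -> (Num.sqrt (sg i))^-1 * (Num.sqrt (sg i))^-1 = (sg i)^-1.
Proof. by move=> s0; rewrite -invfM -expr2 sqr_sqrtr// ltW. Qed.

Let DS k : (D k)^T *m pdiag_mx N N sg = S k *m (D k)^T.
Proof.
rewrite /D /S tr_pdiag_mx !mul_pdiag_mx; apply: eq_pdiag_mx => i ik iN.
by rewrite ik iN mulrC.
Qed.

Let ST k : (S k)^T = S k. Proof. exact: tr_pdiag_mx. Qed.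

Let TlELP k : (Tl k)^T *m E *m LP = S k *m (D k)^T *m Ur^T.
Proof.
have [UlU _ _ _ _] := svdM.
rewrite /Tl !trmx_mul -!mulmxA (mulmxA LQ^T) svdE -!mulmxA (mulmxA Ul^T) UlU mul1mx.
by rewrite mulmxA DS mulmxA.
Qed.

Let TrELQ k : (Tr k)^T *m E^T *m LQ = S k *m (D k)^T *m Ul^T.
Proof.
have [_ UrU _ _ _] := svdM.
have svdT : LP^T *m E^T *m LQ = Ur *m pdiag_mx N N sg *m Ul^T.
  by have := congr1 trmx svdE; rewrite !trmx_mul !trmxK tr_pdiag_mx !mulmxA.
rewrite /Tr !trmx_mul -!mulmxA (mulmxA LP^T) svdT -!mulmxA (mulmxA Ur^T) UrU mul1mx.
by rewrite mulmxA DS mulmxA.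
Qed.

(** Together with [TrEQ] this says that the projections intertwine the two Gramians with the
    diagonal matrix [S k], which is what balancing means for a pencil. *)
Let TlEP k : (Tl k)^T *m E *m P = S k *m (Tr k)^T.
Proof. by rewrite PE mulmxA TlELP /Tr !trmx_mul !mulmxA. Qed.

Let TrEQ k : (Tr k)^T *m E^T *m Q = S k *m (Tl k)^T.
Proof. by rewrite QE mulmxA TrELQ /Tl !trmx_mul !mulmxA. Qed.

(** Compress the full equation by [Tl k] on both sides and move the projections past [P] by [TlEP].
    Each level is thus balanced again, and the next state can be removed from it. *)
Let level_gramP k : let Ak := (Tl k)^T *m A *m Tr k in let Bk := (Tl k)^T *m B in
  Ak *m S k + S k *m Ak^T + Bk *m Bk^T = 0.
Proof.
move=> Ak Bk.
have TlEPT : P *m E^T *m Tl k = Tr k *m S k.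
  by have := congr1 trmx (TlEP k); rewrite tr3 tr2 PT ST.
rewrite /Ak /Bk tr3; have := TlEP k; have := TlEPT.
move: (Tl k) (Tr k) => X Y XP PX; rewrite trmx_mul trmxK.
have : X^T *m (A *m P *m E^T + E *m P *m A^T + B *m B^T) *m X = 0.
  by rewrite gramP mulmx0 mul0mx.
rewrite !mulmxDr !mulmxDl => H; rewrite -[RHS]H; congr (_ + _ + _).
- by rewrite -!mulmxA (mulmxA P) XP.
- by rewrite !mulmxA PX.
- by rewrite !mulmxA.
Qed.

Let level_gramQ k : let Ak := (Tl k)^T *m A *m Tr k in let Ck := C *m Tr k in
  Ak^T *m S k + S k *m Ak + Ck^T *m Ck = 0.
Proof.
move=> Ak Ck.
have TrEQT : Q *m E *m Tr k = Tl k *m S k.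
  by have := congr1 trmx (TrEQ k); rewrite tr3 tr2 QT ST trmxK.
rewrite /Ak /Ck tr3; have := TrEQ k; have := TrEQT.
move: (Tl k) (Tr k) => X Y XP PX; rewrite trmx_mul.
have : Y^T *m (A^T *m Q *m E + E^T *m Q *m A + C^T *m C) *m Y = 0.
  by rewrite gramQ mulmx0 mul0mx.
rewrite !mulmxDr !mulmxDl => H; rewrite -[RHS]H; congr (_ + _ + _).
- by rewrite -!mulmxA (mulmxA Q) XP.
- by rewrite !mulmxA PX.
- by rewrite !mulmxA.
Qed.

Let level_mass k (kN : (k <= N)%N) (k_pos : forall i, (i < k)%N -> 0 < sg i) :
  (Tl k)^T *m E *m Tr k = 1%:M.
Proof.
have [UlU UrU _ _ _] := svdM.
rewrite /Tl /Tr !trmx_mul -!mulmxA (mulmxA LQ^T) (mulmxA (LQ^T *m E)) svdE !mulmxA.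
rewrite -(mulmxA _ Ul^T Ul) UlU mulmx1 DS -!mulmxA (mulmxA Ur^T) UrU mul1mx.
rewrite /S /D tr_pdiag_mx !mul_pdiag_mx -pdiag_mx1; apply: eq_pdiag_mx => i ik _.
by rewrite ik (leq_trans ik kN) sqrt_sg ?k_pos// divff// gt_eqF// k_pos.
Qed.

(** When only zeros are cut off, D S D^T acts as the identity on the diagonal of the decomposition,
    so Tl Tr^T E^T fixes the range of Q E LP = LQ Ul diag(sigma) Ur^T. *)
Let level_unreachable k (k_pos : forall i, (i < k)%N -> 0 < sg i) :
  (forall i, (k <= i)%N -> (i < N)%N -> sg i = 0) ->
  (1%:M - Tl k *m (Tr k)^T *m E^T) *m Q *m E *m LP = 0.
Proof.
move=> sg0; have [UlU UrU _ _ _] := svdM.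
have DSD : D k *m S k *m (D k)^T *m pdiag_mx N N sg = pdiag_mx N N sg.
  rewrite /D /S tr_pdiag_mx !mul_pdiag_mx; apply: eq_pdiag_mx => i iN _.
  rewrite iN; have [ik|ki] := ltnP i k; last by rewrite mul0r sg0.
  by rewrite [_ * sg i / _]mulrAC sqrt_sg ?k_pos// mulVf ?mul1r// gt_eqF// k_pos.
rewrite !mulmxBl mul1mx QE; apply/eqP; rewrite subr_eq0; apply/eqP.
rewrite -!mulmxA (mulmxA (Tr k)^T) (mulmxA ((Tr k)^T *m E^T)) TrELQ.
rewrite (mulmxA LQ^T) svdE /Tl -!mulmxA (mulmxA Ul^T) UlU mul1mx.
by rewrite -{1}DSD !mulmxA.
Qed.

Lemma bt_mass k (le_kN : (k <= N)%N) :
  (forall i : 'I_N, (i < k)%N -> 0 < sigma ord0 i) ->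
  (bt_projection le_kN LQ Ul sigma)^T *m E *m bt_projection le_kN LP Ur sigma = 1%:M.
Proof.
move=> sk; rewrite !bt_projectionE; apply: level_mass => // i ik.
by have iN := leq_trans ik le_kN; rewrite (sgE (Ordinal iN)) sk.
Qed.

(** Induction on N - k, for all trajectories [z] of level k: the trajectory [z1] of level k + 1 with
    the same input is compared with [x] by the induction hypothesis and with [z] by
    [truncation_step], and Minkowski's inequality adds the gains. The induction ends as soon as no
    positive singular value is left, in particular at k = N, where level and full system still
    differ by a change of coordinates. *)
Theorem balanced_truncation_bound k (le_kN : (k <= N)%N) :
  (forall i : 'I_N, (i < k)%N -> 0 < sigma ord0 i) ->
  forall a b u (x : R -> 'cV[R]_N) (z : R -> 'cV[R]_k), a <= b ->
  (forall t, vinteg a t u) -> integ a b (fun t => dot (u t) (u t)) ->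
  x a = 0 -> z a = 0 ->
  vprim a b (fun t => E *m x t) (fun t => A *m x t + B *m u t) ->
  let Tl := bt_projection le_kN LQ Ul sigma in
  let Tr := bt_projection le_kN LP Ur sigma in
  vprim a b z (fun t => Tl^T *m A *m Tr *m z t + Tl^T *m B *m u t) ->
  int_ a b (fun t => dot (C *m x t - C *m Tr *m z t) (C *m x t - C *m Tr *m z t)) <=
  (2 * \sum_(i < N | (k <= i)%N) sigma ord0 i) ^+ 2 * int_ a b (fun t => dot (u t) (u t)).
Proof.
move=> sk a b u x z ab uI ui xa za xP; rewrite /= !bt_projectionE -/(Tl k) -/(Tr k) => zP.
rewrite -/(tail k).
have {}sk i : (i < k)%N -> 0 < sg i.
  by move=> ik; have iN := leq_trans ik le_kN; rewrite (sgE (Ordinal iN)) sk.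
have U0 : 0 <= int_ a b (fun t => dot (u t) (u t)).
  by apply: int_ge0 => t _ _; exact: dot_ge0.
have [n nk] := ubnP (N - k); elim: n => // n IH in k le_kN sk z za zP nk *.
(* If sigma_k vanishes, so do all later singular values, S is no longer invertible,
   and nothing is lost by discarding the corresponding states. *)
have [[kN skpos]|tail0] := pselect ((k < N)%N /\ 0 < sg k); last first.
  have sg0 i : (k <= i)%N -> (i < N)%N -> sg i = 0.
    move=> ki iN; apply/eqP; rewrite eq_le sg_ge0 andbT leNgt; apply/negP => si.
    apply: tail0; split; first exact: leq_ltn_trans iN.
    exact: lt_le_trans (sg_anti ki iN).
  have HLP := level_unreachable sk sg0.
  apply: (le_trans (reduction_of_unreachable (E := E) (P := P) (Q := Q) (A := A) (B := B)
     (C := C) (Tl := Tl k) (Tr := Tr k) Eu PT QT Q_ge0 gramP gramQ _ _ ab xa za xP zP)).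
  - by rewrite PE mulmxA HLP mul0mx.
  - by rewrite /Tr !mulmxA HLP !mul0mx.
  - by rewrite mulr_ge0// sqr_ge0.
have sk1 i : (i < k.+1)%N -> 0 < sg i.
  by rewrite ltnS leq_eqVlt => /predU1P[->|/sk].
pose A1 := (Tl k.+1)^T *m A *m Tr k.+1; pose B1 := (Tl k.+1)^T *m B.
have [z1 [z1a z1P]] := ode_exists A1 (a := a) (g := fun t => B1 *m u t)
  (fun t => vintegM B1 (uI t)).
have {}z1a := z1a a (lexx a).
have nk1 : (N - k.+1 < n)%N by rewrite subnS prednK ?subn_gt0.
have H1 := IH k.+1 kN sk1 z1 z1a (z1P b) nk1.
(* Embeds the first k coordinates of level k + 1. Since D k.+1 J = D k, level k is the truncation of
   level k + 1 along [J]. *)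
pose J : 'M[R]_(k.+1, k) := pdiag_mx k.+1 k (fun=> 1).
have DJ : D k.+1 *m J = D k.
  rewrite /D /J mul_pdiag_mx; apply: eq_pdiag_mx => i iN ik.
  by rewrite mulr1 ltnS ltnW.
have TlJ : Tl k.+1 *m J = Tl k by rewrite /Tl -mulmxA DJ.
have TrJ : Tr k.+1 *m J = Tr k by rewrite /Tr -mulmxA DJ.
have JJ : J^T *m J = 1%:M.
  rewrite /J tr_pdiag_mx mul_pdiag_mx -pdiag_mx1; apply: eq_pdiag_mx => i ik _.
  by rewrite ltnS (ltnW ik) mulr1.
have SD : S k.+1 *m (1%:M - J *m J^T) = sg k *: (1%:M - J *m J^T).
  have -> : 1%:M - J *m J^T = pdiag_mx k.+1 k.+1 (fun i => (i == k)%:R).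
    rewrite /J tr_pdiag_mx mul_pdiag_mx -pdiag_mx1; apply/matrixP => i j.
    rewrite !mxE; case: eqP => _; last by rewrite subr0.
    have := ltn_ord i; rewrite ltnS leq_eqVlt => /predU1P[->|ik].
      by rewrite ltnn subr0 eqxx.
    by rewrite ik mulr1 subrr ltn_eqF.
  rewrite /S mul_pdiag_mx; apply/matrixP => i j; rewrite !mxE ltn_ord.
  by case: eqP => _; rewrite ?mulr0//; case: eqP => [->//|_]; rewrite !mulr0.
have z1P' := z1P b.
have zP' : vprim a b z (fun t => J^T *m A1 *m J *m z t + J^T *m B1 *m u t).
  apply: vprim_eq zP => // t _ _; rewrite -TlJ -TrJ /A1 /B1 trmx_mul.
  by rewrite !mulmxA.
have H2 : int_ a b (fun t => dot (C *m Tr k.+1 *m z1 t - C *m Tr k.+1 *m J *m z t)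
    (C *m Tr k.+1 *m z1 t - C *m Tr k.+1 *m J *m z t)) <=
    (2 * sg k) ^+ 2 * int_ a b (fun t => dot (u t) (u t)).
  apply: (truncation_step (A := A1) (B := B1) (S := S k.+1)
    (Si := pdiag_mx k.+1 k.+1 (fun i => (sg i)^-1)) _ _ _ _ _ _ _ JJ skpos SD
    ab z1a za z1P' zP' ui).
  - exact: tr_pdiag_mx.
  - exact: tr_pdiag_mx.
  - by move=> y; apply: dot_pdiag_ge0.
  - by move=> y; apply: dot_pdiag_ge0 => i _; rewrite invr_ge0.
  - rewrite /S mul_pdiag_mx -pdiag_mx1; apply: eq_pdiag_mx => i ik _.
    by rewrite ik mulVf// gt_eqF// sk1.
  - exact: level_gramP.
  - exact: level_gramQ.
have xP' : vprim a b x (fun t => invmx E *m (A *m x t + B *m u t)).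
  by apply: vprim_eq (vprimM (invmx E) xP) => // t _ _; rewrite mulKmx.
have e1P := vprimB (vprimM C xP') (vprimM (C *m Tr k.+1) z1P').
have e2P := vprimB (vprimM (C *m Tr k.+1) z1P') (vprimM (C *m Tr k.+1 *m J) zP').
have e3P := vprimD e1P e2P.
have c0 : 0 <= 2 * tail k.+1 by rewrite mulr_ge0.
have d0 : 0 <= 2 * sg k by rewrite mulr_ge0.
have := int_minkowski c0 d0 U0 (integ_dot e1P e1P) (integ_dot e2P e2P) (integ_dot e3P e3P) H1 H2.
rewrite (tailS kN) mulrDr [2 * sg k + _]addrC; congr (_ <= _); apply: int_eq => t _ _.
by rewrite addrA subrK -(mulmxA C) TrJ.
Qed.


End BalancedTruncation.

(** * System norms as gains *)

Section SquareIntegrable.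
Context {R : realType}.
Notation mu := (@lebesgue_measure R).
Implicit Types (a b c d L : R).

Definition nsq k (I : set R) (x : R -> 'cV[R]_k) : \bar R :=
  (\int[mu]_(t in I) (dot (x t) (x t))%:E)%E.

Lemma nsq_ge0 k I (x : R -> 'cV[R]_k) : (0 <= nsq I x)%E.
Proof. by apply: integral_ge0 => t _; rewrite lee_fin dot_ge0. Qed.

Lemma L2normE k I (x : R -> 'cV[R]_k) : L2norm I x = sqrte (nsq I x).
Proof. by []. Qed.

Lemma measurable_dot k (I : set R) (x : R -> 'cV[R]_k) : measurable I ->
  (forall i, measurable_fun I (fun t => x t i ord0)) ->
  measurable_fun I (fun t => dot (x t) (x t)).
Proof.
move=> mI mx; rewrite (_ : (fun t => _) = (fun t => \sum_i x t i ord0 * x t i ord0)).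
  by apply: measurable_sum => i; apply: measurable_funM.
by apply/funext => t; rewrite dotE.
Qed.

Lemma L2fun_nsq k I (x : R -> 'cV[R]_k) : L2fun I x ->
  exists2 U : R, 0 <= U & nsq I x = U%:E.
Proof.
move=> [_]; rewrite L2normE => xy.
have : nsq I x \is a fin_num.
  by rewrite -sqrte_fin_num ?nsq_ge0// ge0_fin_numE// sqrte_ge0.
move=> /fineK <-; exists (fine (nsq I x)) => //.
by rewrite fine_ge0// nsq_ge0.
Qed.

Definition restr k (I : set R) (x : R -> 'cV[R]_k) (t : R) : 'cV[R]_k :=
  if t \in I then x t else 0.

Lemma restr_sqr k I (x : R -> 'cV[R]_k) :
  (fun t => dot (restr I x t) (restr I x t)) = (fun t => dot (x t) (x t)) \_ I.
Proof.
by apply/funext => t; rewrite /restr patchE; case: ifP => // _; rewrite dot0l.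
Qed.

(** On a segment |r| <= 1 + r^2 makes square integrable inputs integrable, as the integrated
    equation requires. *)
Lemma L2fun_restr k I (x : R -> 'cV[R]_k) a b : measurable I -> L2fun I x ->
  [/\ vinteg a b (restr I x), integ a b (fun t => dot (restr I x t) (restr I x t)) &
    ((int_ a b (fun t => dot (restr I x t) (restr I x t)))%:E <= nsq I x)%E].
Proof.
move=> mI xL; have [mx xy] := xL; have [U U0 UE] := L2fun_nsq xL.
have mdx := measurable_dot mI mx.
have xi : mu.-integrable I (EFin \o (fun t => dot (x t) (x t))).
  apply/integrableP; split; first exact/measurable_EFinP.
  rewrite [ltLHS](_ : _ = nsq I x); first by rewrite UE ltry.
  by rewrite /nsq; apply: eq_integral => t _; rewrite /= ger0_norm// dot_ge0.
have wi : mu.-integrable setT (EFin \o (fun t => dot (restr I x t) (restr I x t))).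
  by rewrite restr_sqr -restrict_EFin -integrable_mkcond.
have wab : integ a b (fun t => dot (restr I x t) (restr I x t)).
  exact: integrableS wi.
split=> //.
- move=> i; have mw : measurable_fun `[a, b] (fun t => restr I x t i ord0).
    apply: (@measurable_funS _ _ _ _ setT) => //.
    rewrite (_ : (fun t => _) = (fun t => x t i ord0) \_ I).
      exact/(measurable_restrictT _ mI).
    apply/funext => t; rewrite /restr patchE; case: ifP => // _; by rewrite mxE.
  apply: le_integrable (integD (integ_cst a b 1) wab) => //.
    exact/measurable_EFinP.
  move=> t _ /=; rewrite lee_fin [leRHS]ger0_norm ?addr_ge0 ?dot_ge0//.
  apply: (@le_trans _ _ (1 + restr I x t i ord0 ^+ 2)); last first.
    by rewrite lerD2l sqr_coord_le_dot.
  move: (restr _ _ _ _ _) => r; rewrite -(real_normK (num_real r)).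
  by move: `|r| (normr_ge0 r) => s s0; have := sqr_ge0 (s - 2^-1); nra.
- rewrite /int_ /Rintegral fineK; last exact: integrable_fin_num wab.
  rewrite /nsq [leRHS]integral_mkcond.
  have -> : (fun t => (dot (x t) (x t))%:E) \_ I =
      EFin \o (fun t => dot (restr I x t) (restr I x t)).
    by rewrite restr_sqr -restrict_EFin.
  apply: ge0_subset_integral => //.
  + by case/integrableP: wi.
  + by move=> t _; rewrite /= lee_fin dot_ge0.
Qed.

Lemma L2fun_sub k I J (x : R -> 'cV[R]_k) : measurable I -> measurable J -> I `<=` J ->
  L2fun J x -> L2fun I x.
Proof.
move=> mI mJ IJ xL; have [mx _] := xL; have [U U0 UE] := L2fun_nsq xL.
split=> [i|]; first exact: measurable_funS (mx i).
rewrite L2normE; apply: (@le_lt_trans _ _ (sqrte U%:E)); last by rewrite /= ltry.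
rewrite lee_sqrt// -UE; apply: ge0_subset_integral => //.
  by apply/measurable_EFinP; exact: measurable_dot.
by move=> t _; rewrite lee_fin dot_ge0.
Qed.

Lemma nsq_int k a b (x : R -> 'cV[R]_k) : integ a b (fun t => dot (x t) (x t)) ->
  nsq `[a, b] x = (int_ a b (fun t => dot (x t) (x t)))%:E.
Proof. by move=> xi; rewrite /nsq /int_ /Rintegral fineK//; exact: integrable_fin_num xi. Qed.

Lemma measurable_future : measurable (@future R). Proof. exact: measurable_itv. Qed.
Lemma measurable_past : measurable (@past R). Proof. exact: measurable_itv. Qed.

(** Monotone convergence along the segments [[0, n]]; outputs are therefore only ever estimated on
    compact segments. *)
Lemma nsq_futureP k (y : R -> 'cV[R]_k) (K : R) :
  (forall b, integ 0 b (fun t => dot (y t) (y t))) ->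
  (nsq future y <= K%:E)%E <-> forall L, 0 <= L -> int_ 0 L (fun t => dot (y t) (y t)) <= K.
Proof.
move=> yi; have futureE : future = \bigcup_n `[0, n%:R]%classic :> set R.
  apply/seteqP; split=> t; rewrite /future/= in_itv/= ?andbT => H.
    exists (Num.bound t) => //=; rewrite in_itv/= H/=.
    by rewrite ltW// archi_boundP.
  by have [n _] := H; rewrite /= in_itv/= => /andP[].
have mF : measurable_fun future (fun t => (dot (y t) (y t))%:E).
  rewrite futureE; apply/measurable_fun_bigcup => // n.
  exact: measurable_int (yi _).
split=> [H L L0|H].
  rewrite -lee_fin -nsq_int//; apply: le_trans H.
  apply: ge0_subset_integral => //; first exact: measurable_future.
    by move=> t _; rewrite lee_fin dot_ge0.
  by apply: subset_itvl; rewrite bnd_simp.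
have cvgI := @ge0_nondecreasing_set_cvg_integral _ _ R
  (fun n => `[0, n%:R]%classic : set (measurableTypeR R)) (fun t => (dot (y t) (y t))%:E) mu.
rewrite /nsq futureE; apply: (cvge_le _ (cvgI _ _ _ _)) => //.
- by apply: nearW => n; rewrite [leLHS]nsq_int// lee_fin H.
- move=> n m nm; apply/subsetPset; apply: subset_itvl.
  by rewrite bnd_simp ler_nat.
- by move=> n; exact: measurable_int (yi _).
- by move=> n t _; rewrite lee_fin dot_ge0.
Qed.

Lemma L2norm_ratio_le k l (I F : set R) (u : R -> 'cV[R]_k) (y : R -> 'cV[R]_l) (U eta : R) :
  nsq I u = U%:E -> 0 < U -> 0 <= eta ->
  (L2norm F y / L2norm I u <= eta%:E)%E = (nsq F y <= (eta ^+ 2 * U)%:E)%E.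
Proof.
move=> uU U0 eta0; rewrite !L2normE uU.
have sU0 : 0 < Num.sqrt U by rewrite sqrtr_gt0.
have -> : (sqrte U%:E)^-1%E = ((Num.sqrt U)^-1)%:E by rewrite /= inver gt_eqF.
rewrite lee_pdivrMr// -EFinM.
have -> : ((eta * Num.sqrt U)%:E = sqrte (eta ^+ 2 * U)%:E)%E.
  by rewrite /= sqrtrM ?sqr_ge0// sqrtr_sqr ger0_norm.
by rewrite lee_sqrt// lee_fin mulr_ge0// ?sqr_ge0// ltW.
Qed.

Lemma nsq_eq0 k I (u : R -> 'cV[R]_k) : (L2norm I u == 0%E) = (nsq I u == 0%E).
Proof.
rewrite L2normE; apply/eqP/eqP => [H|->]; last by rewrite sqrte0.
by rewrite -(sqr_sqrte (nsq_ge0 I u)) H expe2 mul0e.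
Qed.

End SquareIntegrable.

(** * Trajectories on segments and on the whole line *)

Section Trajectories.
Context {R : realType}.
Implicit Types (a b c d s t L : R).

Lemma integ_cat a b c (f : R -> R) : integ a c f -> integ c b f -> integ a b f.
Proof.
move=> f1 f2.
have r (D : set R) d e : measurable D -> `[a, b] `&` D `<=` `[d, e] ->
    integ d e f -> integ a b (f \_ D).
  move=> mD sub fi; rewrite /integ -restrict_EFin; apply/integrable_restrict => //.
  by apply: integrableS fi => //; exact: measurableI.
have g1 : integ a b (f \_ `[a, c]) by apply: r f1 => //; exact: subIsetr.
have g2 : integ a b (f \_ `]c, b]).
  apply: r f2 => //; apply: subset_trans (@subIsetr _ _ _) _.
  by apply: subset_itvr; rewrite bnd_simp.
apply: integ_eq (integD g1 g2) => x ax xb.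
rewrite !patchE; have [xc|cx] := leP x c.
  rewrite mem_set/= ?in_itv/= ?ax// memNset/= ?addr0// in_itv/= => /andP[cx _].
  by move: cx; rewrite ltNge xc.
rewrite memNset/= ?add0r ?mem_set//= ?in_itv/= ?cx ?xb// => /andP[_ xc].
by move: cx; rewrite ltNge xc.
Qed.

(** The left end is a null set. It matters because an input cut off to []a, 0]] loses its value at
    [a]. *)
Lemma int_obnd a b (f g : R -> R) : integ a b f -> integ a b g ->
  (forall x, a < x -> x <= b -> f x = g x) -> int_ a b f = int_ a b g.
Proof.
move=> fi gi fg; have sub : (`]a, b]%classic : set R) `<=` `[a, b].
  by apply: subset_itvr; rewrite bnd_simp.
rewrite /int_ -!Rintegral_itv_obnd_cbnd; first last.
- exact: integrableS fi.
- exact: integrableS gi.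
by apply: eq_Rintegral => x; rewrite inE/= in_itv/= => /andP[ax xb]; rewrite fg.
Qed.

(** Solutions are constructed to the right of [a] only; gluing them to zero gives solutions on the
    whole line. *)
Lemma primitive_extend a (F f : R -> R) :
  (forall t, t <= a -> F t = 0) -> (forall t, t <= a -> f t = 0) ->
  (forall b, primitive a b F f) -> forall c d, primitive c d F f.
Proof.
move=> F0 f0 Ff c d; pose c' := Num.min a c.
have ca : c' <= a by rewrite ge_min lexx.
suff H : primitive c' (Num.max a d) F f.
  by apply: primitive_sub H; rewrite ?ge_min ?le_max lexx orbT.
have ad : a <= Num.max a d by rewrite le_max lexx.
move: (Num.max a d) ad => b ab; have [_ fi _] := Ff b.
have fi0 : integ c' a f.
  by apply: integ_eq (integ_cst c' a 0) => x _ xa; rewrite f0.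
have fi' := integ_cat fi0 fi.
apply: primitive_eq (primitive_int 0 fi') => // t ct tb; rewrite add0r.
have i0 x : x <= a -> int_ c' x f = 0.
  move=> xa; have [cx|xc] := leP c' x; last by rewrite int_gt.
  rewrite (@int_eq _ _ _ _ (fun=> 0)); first by rewrite int_cst// mul0r.
  by move=> y _ yx; rewrite f0// (le_trans yx).
have [ta|at_] := leP t a; first by rewrite i0// F0.
have [_ _ H] := Ff b.
rewrite (int_cat ca (ltW at_)); last exact: integ_sub fi'.
by rewrite i0// add0r -(H a t) ?(ltW at_)// (F0 a)// subr0.
Qed.

Lemma vprim_extend n a (X x : R -> 'cV[R]_n) :
  (forall t, t <= a -> X t = 0) -> (forall t, t <= a -> x t = 0) ->
  (forall b, vprim a b X x) -> forall c d, vprim c d X x.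
Proof.
move=> X0 x0 Xx c d i; apply: (@primitive_extend a).
- by move=> t /X0->; rewrite mxE.
- by move=> t /x0->; rewrite mxE.
- by move=> b; exact: Xx.
Qed.

Lemma cvg_cV n (F : set_system R) {FF : Filter F} (x : R -> 'cV[R]_n) (l : 'cV[R]_n) :
  (forall i, (fun t => x t i ord0) @ F --> l i ord0) -> x @ F --> l.
Proof.
move=> H; apply/cvg_ballP => e e0.
have : \forall t \near F, forall i, ball (l i ord0) e (x t i ord0).
  by apply: filter_forall => i; have /cvg_ballP := H i; apply.
apply: filterS => t tP; split=> // i j.
by rewrite (ord1 j); exact: tP.
Qed.

Lemma continuous_coord n (I : set R) (x : R -> 'cV[R]_n) i :
  {within I, continuous x} -> {within I, continuous (fun t => x t i ord0)}.
Proof.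
by move=> xc t; apply: (@cvg_comp _ _ _ x (fun M : 'cV[R]_n => M i ord0) _ (nbhs (x t)));
  [exact: xc|exact: coord_continuous].
Qed.

Variables (N nin p : nat).
Implicit Type S : lti_system R N nin p.

(** The equation of [trajectory] on one segment, in the form on which the calculus of primitives
    operates; E x rather than x carries the equation. *)
Definition on_segment S a b (u : R -> 'cV[R]_nin) (x : R -> 'cV[R]_N) :=
  vprim a b (fun t => sysE S *m x t) (fun t => sysA S *m x t + sysB S *m u t).

Lemma on_segment_state S a b u x : sysE S \in unitmx -> on_segment S a b u x ->
  vprim a b x (fun t => invmx (sysE S) *m (sysA S *m x t + sysB S *m u t)).
Proof.
by move=> Eu xP; apply: vprim_eq (vprimM (invmx (sysE S)) xP) => // t _ _; rewrite mulKmx.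
Qed.

Lemma on_segmentB S a b u u' x x' : on_segment S a b u x -> on_segment S a b u' x' ->
  on_segment S a b (fun t => u t - u' t) (fun t => x t - x' t).
Proof.
move=> xP xP'; apply: vprim_eq (vprimB xP xP') => t _ _; rewrite !mulmxBr//.
by rewrite opprD addrACA.
Qed.

Lemma integ_output S a b u x : sysE S \in unitmx -> on_segment S a b u x ->
  integ a b (fun t => dot (sysC S *m x t) (sysC S *m x t)).
Proof.
by move=> Eu /(on_segment_state Eu) xP; apply: integ_dot; exact: vprimM xP.
Qed.

Lemma trajectory_on_segment S (I : set R) a b u x : sysE S \in unitmx ->
  `[a, b] `<=` I -> vinteg a b u -> trajectory S I u x -> on_segment S a b u x.
Proof.
move=> Eu abI ui [xc xE].
have xi : vinteg a b x.
  move=> i; apply/integ_continuous/continuous_coord.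
  exact: continuous_subspaceW xc.
have hi : vinteg a b (fun t => sysA S *m x t + sysB S *m u t).
  by apply: vintegD; exact: vintegM.
have inI t : a <= t -> t <= b -> I t by move=> ta tb; apply: abI; rewrite /= in_itv/= ta.
move=> i; pose r := (sysE S *m x a) i ord0.
apply: primitive_eq (primitive_int r (hi i)) => // t ta tb.
have := xE a t (inI a (lexx a) (le_trans ta tb)) (inI t ta tb) ta.
move=> /(congr1 (fun M : 'cV[R]_N => M i ord0)); rewrite mulmxBr.
rewrite [RHS]mxE mxE [X in _ + X]mxE -/r -/(int_ _ _ _) => <-.
by rewrite subrKC.
Qed.

Lemma trajectory_future S u x : sysE S \in unitmx ->
  (forall b, on_segment S 0 b u x) -> trajectory S (@future R) u x.
Proof.
move=> Eu xP; split.
- apply/subspace_continuousP => t; rewrite /future/= in_itv/= andbT => t0.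
  apply: cvg_cV => i; have [/subspace_continuousP + _ _] := on_segment_state Eu (xP (t + 1)) i.
  have tt1 : t <= t + 1 by rewrite lerDl.
  move=> /(_ t); rewrite /= in_itv/= t0 tt1 => /(_ isT).
  move=> /cvgrPdist_lt H; apply/cvgrPdist_lt => e e0.
  have := H e e0; rewrite !near_withinE; apply: filter_app.
  near=> s => + s0; apply; move: s0; rewrite /= !in_itv/= andbT => -> /=.
  have : s < t + 1 by near: s; apply: lt_nbhsl; rewrite ltrDl.
  exact: ltW.
- move=> s t; rewrite /future/= !in_itv/= !andbT => s0 t0 st.
  apply/colP => i; have [_ _] := xP t i => /(_ s t s0 st (lexx t)).
  by move=> H; rewrite mulmxBr [RHS]mxE mxE [X in _ + X]mxE H.
Unshelve. all: by end_near. Qed.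

Lemma trajectory_setT S u x : sysE S \in unitmx ->
  (forall c d, on_segment S c d u x) -> trajectory S setT u x.
Proof.
move=> Eu xP; split.
- apply: continuous_subspaceT => t; apply: cvg_cV => i.
  have [/continuous_within_itvP + _ _] := on_segment_state Eu (xP (t - 1) (t + 1)) i.
  have tt : t - 1 < t + 1 by lra.
  move=> /(_ tt)[H _ _]; apply: H; rewrite in_itv/=; apply/andP; split; lra.
- move=> s t _ _ st.
  apply/colP => i; have [_ _] := xP s t i => /(_ s t (lexx s) st (lexx t)).
  by move=> H; rewrite mulmxBr [RHS]mxE mxE [X in _ + X]mxE H.
Qed.

Lemma on_segment_exists S a (u : R -> 'cV[R]_nin) : sysE S \in unitmx ->
  (forall b, vinteg a b u) ->
  exists x, (forall t, t <= a -> x t = 0) /\ forall b, on_segment S a b u x.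
Proof.
move=> Eu ui.
have [x [x0 xP]] := ode_exists (invmx (sysE S) *m sysA S) (a := a)
  (fun b => vintegM (invmx (sysE S) *m sysB S) (ui b)).
exists x; split=> // b; apply: vprim_eq (vprimM (sysE S) (xP b)) => // t _ _.
by rewrite mulmxDr -!mulmxA !mulKVmx.
Qed.

Lemma on_line_exists S a (u : R -> 'cV[R]_nin) : sysE S \in unitmx ->
  (forall b, vinteg a b u) -> (forall t, t <= a -> u t = 0) ->
  exists x, (forall t, t <= a -> x t = 0) /\ forall c d, on_segment S c d u x.
Proof.
move=> Eu ui u0; have [x [x0 xP]] := on_segment_exists Eu ui.
exists x; split=> // c d; apply: (@vprim_extend _ a) => // t ta.
- by rewrite x0// mulmx0.
- by rewrite x0// u0// !mulmx0 addr0.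
Qed.

End Trajectories.

(** * Cut-off inputs *)

Section RestrictedInputs.
Context {R : realType}.

Lemma nsq_restr k (I F : set R) (x : R -> 'cV[R]_k) : I `<=` F ->
  nsq F (restr I x) = nsq I x.
Proof.
move=> IF; rewrite -[in RHS](setIidr IF) /nsq integral_mkcondr.
apply: eq_integral => t _.
by rewrite patchE /restr; case: ifP => // _; rewrite dot0l.
Qed.

Lemma L2fun_restr_sub k (I F : set R) (x : R -> 'cV[R]_k) : measurable I -> measurable F ->
  I `<=` F -> L2fun I x -> L2fun F (restr I x).
Proof.
move=> mI mF IF [mx xy]; split=> [i|]; last by rewrite L2normE nsq_restr.
apply: (@measurable_funS _ _ _ _ setT) => //.
rewrite (_ : (fun t => _) = (fun t => x t i ord0) \_ I).
  exact/(measurable_restrictT _ mI).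
by apply/funext => t; rewrite /restr patchE; case: ifP => // _; rewrite mxE.
Qed.

Lemma nsq_sub k (I J : set R) (x : R -> 'cV[R]_k) : measurable I -> measurable J -> I `<=` J ->
  L2fun J x -> (nsq I x <= nsq J x)%E.
Proof.
move=> mI mJ IJ [mx _]; apply: ge0_subset_integral => //.
  by apply/measurable_EFinP; exact: measurable_dot.
by move=> t _; rewrite lee_fin dot_ge0.
Qed.

(** For n > 0 this is a nonzero test input: it shows that the suprema defining the norms run over
    nonempty sets and hence are nonnegative. *)
Lemma L2fun_one n (a b : R) : a <= b ->
  L2fun `]a, b] (fun=> const_mx 1 : 'cV[R]_n) /\
  nsq `]a, b] (fun=> const_mx 1 : 'cV[R]_n) = (n%:R * (b - a))%:E.
Proof.
move=> ab; have nE : nsq `]a, b] (fun=> const_mx 1 : 'cV[R]_n) = (n%:R * (b - a))%:E.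
  rewrite /nsq integral_cst//= lebesgue_measure_itv/= lte_fin.
  rewrite dotE (eq_bigr (fun=> 1)) => [|i _]; last by rewrite mxE mulr1.
  rewrite sumr_const card_ord; case: ltgtP ab => // -> _.
  by rewrite subrr mulr0 mule0.
split=> //; split=> [i|]; first exact: measurable_cst.
by rewrite L2normE nE /= ltry.
Qed.

Lemma cvg_dot0 n (F : set_system R) {FF : Filter F} (x : R -> 'cV[R]_n) :
  x @ F --> (0 : 'cV[R]_n) -> dot (x t) (x t) @[t --> F] --> (0 : R).
Proof.
move=> x0; have -> : (fun t => dot (x t) (x t)) = (fun t => \sum_i x t i ord0 * x t i ord0).
  by apply/funext => t; rewrite dotE.
elim: (index_enum _) => [|i r IH].
  by under eq_fun do rewrite big_nil; exact: cvg_cst.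
under eq_fun do rewrite big_cons.
have xi : x t i ord0 @[t --> F] --> (0 : 'cV[R]_n) i ord0.
  exact: (@cvg_comp _ _ _ x (fun M : 'cV[R]_n => M i ord0) _ (nbhs (0 : 'cV[R]_n)) _ x0
    (@coord_continuous _ _ _ _ _ _)).
by have := cvgD (cvgM xi xi) IH; rewrite mxE mulr0 addr0; exact.
Qed.

End RestrictedInputs.

(** * Norm bounds as inequalities for outputs on compact segments *)

Section Gains.
Context {R : realType}.
Implicit Types (a b c d s t L : R).

Let F := @future R.
Let Pa := @past R.

Let mItv a : measurable (`]a, 0]%classic : set R). Proof. exact: measurable_itv. Qed.

Let subPast a : (`]a, 0]%classic : set R) `<=` Pa.
Proof. by rewrite /Pa /past; apply: subset_itvr; rewrite bnd_simp. Qed.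

Let future_int k (w : R -> 'cV[R]_k) b : L2fun F w ->
  [/\ vinteg 0 b w, integ 0 b (fun t => dot (w t) (w t)) &
  ((int_ 0 b (fun t => dot (w t) (w t)))%:E <= nsq F w)%E].
Proof.
move=> /(L2fun_restr 0 b (@measurable_future R))[w1 w2 w3].
have E t : 0 <= t -> restr (@future R) w t = w t.
  by move=> t0; rewrite /restr mem_set//= /future/= in_itv/= t0.
split.
- by move=> i; apply: integ_eq (w1 i) => t t0 _; rewrite E.
- by apply: integ_eq w2 => t t0 _; rewrite E.
- by apply: le_trans w3; rewrite lee_fin le_eqVlt; apply/orP; left; apply/eqP/int_eq => t t0 _;
    rewrite E.
Qed.

Section OneSystem.
Variables (N nin p : nat) (S : lti_system R N nin p).
Hypothesis st : asymptotically_stable (sysE S) (sysA S).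

Let Eu : sysE S \in unitmx. Proof. by have [] := st. Qed.

(* The past inputs are cut off before some finite time a, at which the state vanishes. *)
Definition hankel_gain (eta : R) := forall a w x (U : R), a <= 0 ->
  L2fun `]a, 0] w -> nsq `]a, 0] w = U%:E -> (forall t, t <= a -> x t = 0) ->
  (forall c d, on_segment S c d (restr `]a, 0] w) x) ->
  forall L, 0 <= L ->
  int_ 0 L (fun t => dot (sysC S *m x t) (sysC S *m x t)) <= eta ^+ 2 * U.

Definition future_gain (eta : R) := forall w x (U : R),
  L2fun F w -> nsq F w = U%:E -> x 0 = 0 ->
  (forall b, on_segment S 0 b w x) ->
  forall L, 0 <= L ->
  int_ 0 L (fun t => dot (sysC S *m x t) (sysC S *m x t)) <= eta ^+ 2 * U.

(** Serves twice: with x a = 0 it yields a finite gain, with an input of norm 0 it bounds the free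
    motion started in [x a]. *)
Lemma stable_output : exists k1 k2 : R, [/\ 0 <= k1, 0 <= k2 &
  forall a b u x, a <= b -> integ a b (fun t => dot (u t) (u t)) -> on_segment S a b u x ->
  int_ a b (fun t => dot (sysC S *m x t) (sysC S *m x t)) <=
  k1 * dot (x a) (x a) + k2 * int_ a b (fun t => dot (u t) (u t))].
Proof.
have [Y [c [c0 Y0 H]]] := stable_energy (sysB S) st.
have [cC cC0 CP] := dot_mulmx_bound (sysC S).
have [cV cV0 VP] := dot_mulmx_bound (Y *m sysE S).
have [cE cE0 EP] := dot_mulmx_bound (sysE S).
exists (cC * (cE + cV)), (cC * c); split; rewrite ?mulr_ge0// ?addr_ge0//.
move=> a b u x ab ui xP; have [xi xb] := H a b u x ab ui xP.
have yi := integ_output Eu xP.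
apply: (@le_trans _ _ (cC * int_ a b (fun t => dot (x t) (x t)))).
  rewrite -intZ//; apply: (int_le yi (integZ cC xi)) => t _ _; exact: CP.
rewrite -mulrA -(mulrA cC c) -mulrDr ler_wpM2l//; apply: (le_trans xb).
rewrite lerD2r; have := dot_young (sysE S *m x a) (Y *m (sysE S *m x a)) (@ltr01 R).
have := EP (x a); have := VP (x a); rewrite invr1 !mul1r -mulmxA; lra.
Qed.

Lemma L2_system_normP (eta : R) : 0 <= eta ->
  (L2_system_norm S <= eta%:E)%E <-> future_gain eta.
Proof.
move=> eta0; have [k1 [k2 [k10 k20 K]]] := stable_output; split=> [H|H].
- move=> w x U wL wU x0 xP L L0.
  have [wi1 wi2 wi3] := future_int L wL.
  have U0 : 0 <= U by rewrite -lee_fin -wU nsq_ge0.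
  move: U0; rewrite le_eqVlt => /predU1P[U0|U0].
    (* Inputs of norm 0 do not occur in the supremum; stability shows that their output vanishes. *)
    rewrite -U0 mulr0; apply: (le_trans (K _ _ _ _ L0 wi2 (xP L))).
    by rewrite x0 dot0l mulr0 add0r mulr_ge0_le0// -lee_fin (le_trans wi3)// wU -U0.
  have yi b := integ_output Eu (xP b).
  suff : (nsq (@future R) (fun t => sysC S *m x t)%R <= (eta ^+ 2 * U)%:E)%E.
    by move=> /(nsq_futureP _ yi); apply.
  rewrite -(L2norm_ratio_le _ _ wU)//; apply: le_trans H.
  apply: ereal_sup_ubound; exists w, x; split=> //.
    by rewrite nsq_eq0 wU eqe gt_eqF.
  exact: trajectory_future.
- apply: ge_ereal_sup => _ [w [x [wL w0 xP x0 ->]]].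
  have [U U0 wU] := L2fun_nsq wL.
  have {}U0 : 0 < U by rewrite lt_def U0 andbT; move: w0; rewrite nsq_eq0 wU eqe.
  have xP' b : on_segment S 0 b w x.
    have [wi1 _ _] := future_int b wL.
    apply: trajectory_on_segment xP => //.
    by rewrite /future; apply: subset_itvl; rewrite bnd_simp.
  rewrite (L2norm_ratio_le _ _ wU)//; apply/nsq_futureP.
    by move=> b; exact: integ_output (xP' b).
  exact: H wL wU x0 xP'.
Qed.

Lemma L2_system_norm_ge0 : (0 < nin)%N -> (0 <= L2_system_norm S)%E.
Proof.
move=> nin0; have [oL oU] := L2fun_one nin (@ler01 R).
have sub : (`]0, 1]%classic : set R) `<=` F.
  by rewrite /F /future; apply: subset_itv; rewrite bnd_simp.
pose w := restr `]0, 1] (fun=> const_mx 1 : 'cV[R]_nin).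
have wL : L2fun F w by apply: L2fun_restr_sub => //; exact: measurable_future.
have wU : nsq F w = nin%:R%:E by rewrite nsq_restr// oU subr0 mulr1.
have [x [x0 xP]] := on_segment_exists (a := 0) Eu
  (fun b => let: And3 h _ _ := future_int b wL in h).
apply: le_trans (ereal_sup_ubound _); last first.
  exists w, x; split=> //.
  - by rewrite nsq_eq0 wU eqe gt_eqF// ltr0n.
  - exact: trajectory_future.
  - exact: x0.
by rewrite mule_ge0// ?sqrte_ge0// inve_ge0 sqrte_ge0.
Qed.

Let line_sup a w x (U : R) : a <= 0 -> L2fun `]a, 0] w -> nsq `]a, 0] w = U%:E -> 0 < U ->
  (forall t, t <= a -> x t = 0) ->
  (forall c d, on_segment S c d (restr `]a, 0] w) x) ->
  (L2norm F (fun t => sysC S *m x t)%R / L2norm Pa (restr `]a, 0] w)%R <= hankel_norm S)%E.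
Proof.
move=> a0 wL wU U0 x0 xP; apply: ereal_sup_ubound.
exists (restr `]a, 0] w), x; split=> //.
- by apply: L2fun_restr_sub => //; exact: measurable_past.
- by rewrite nsq_eq0 nsq_restr// wU eqe gt_eqF.
- rewrite (_ : (fun t => _) = restr `]a, 0] w); first exact: trajectory_setT.
  apply/funext => t; case: ltP => // t0.
  by rewrite /restr memNset//= in_itv/= => /andP[_]; rewrite leNgt t0.
- apply: cvg_near_cst; near=> t; apply: x0.
  by near: t; apply: nbhs_ninfty_le; rewrite num_real.
Unshelve. all: by end_near. Qed.

Lemma hankel_norm_ge0 : (0 < nin)%N -> (0 <= hankel_norm S)%E.
Proof.
move=> nin0; have a0 : -1 <= 0 :> R by rewrite oppr_le0.
have [oL oU] := L2fun_one nin a0.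
have [x [x0 xP]] := on_line_exists (a := -1) (u := restr `](-1), 0] (fun=> const_mx 1)) Eu
  (fun b => let: And3 h _ _ := L2fun_restr (-1) b (mItv (-1)) oL in h)
  (fun t (ht : t <= -1) => ltac:(by rewrite /restr memNset//= in_itv/= ltNge ht)).
apply: le_trans (line_sup a0 oL oU _ x0 xP).
  by rewrite mule_ge0// ?sqrte_ge0// inve_ge0 sqrte_ge0.
by rewrite sub0r opprK mulr1 ltr0n.
Qed.

(** The supremum admits trajectories that merely tend to 0 at -oo, whereas the gain concerns
    trajectories that vanish before some [a]. The room [e] granted by [le_sqr_limit] pays for
    replacing the former by the latter. *)
Lemma hankel_normP (eta : R) : 0 <= eta ->
  (hankel_norm S <= eta%:E)%E <-> hankel_gain eta.
Proof.
move=> eta0; have [k1 [k2 [k10 k20 K]]] := stable_output; split=> [H|H].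
- move=> a w x U a0 wL wU x0 xP L L0.
  have [_ wi2 wi3] := L2fun_restr a L (mItv a) wL.
  have U0 : 0 <= U by rewrite -lee_fin -wU nsq_ge0.
  have yi b := integ_output Eu (xP 0 b).
  move: U0; rewrite le_eqVlt => /predU1P[U0|U0].
    rewrite -U0 mulr0; have aL := le_trans a0 L0.
    apply: (@le_trans _ _ (int_ a L (fun t => dot (sysC S *m x t) (sysC S *m x t)))).
      apply: int_mono => //; first exact: integ_output (xP _ _).
      by move=> t _ _; exact: dot_ge0.
    apply: (le_trans (K _ _ _ _ aL wi2 (xP _ _))).
    by rewrite x0// dot0l mulr0 add0r mulr_ge0_le0// -lee_fin (le_trans wi3)// wU -U0.
  suff : (nsq (@future R) (fun t => sysC S *m x t)%R <= (eta ^+ 2 * U)%:E)%E.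
    by move=> /(nsq_futureP _ yi); apply.
  have wPa : nsq Pa (restr `]a, 0] w) = U%:E by rewrite nsq_restr.
  rewrite -(L2norm_ratio_le _ _ wPa)//.
  exact: le_trans (line_sup a0 wL wU U0 x0 xP) H.
- apply: ge_ereal_sup => _ [u [v [uL u0 vP v0 ->]]].
  have [U U0 uU] := L2fun_nsq uL.
  have {}U0 : 0 < U by rewrite lt_def U0 andbT; move: u0; rewrite nsq_eq0 uU eqe.
  have {}vP : trajectory S setT (restr Pa u) v.
    rewrite (_ : restr Pa u = (fun t => if t <= 0 then u t else 0))//.
    by apply/funext => t; rewrite /restr /Pa /past mem_setE in_itv.
  have uI c d := L2fun_restr c d (@measurable_past R) uL.
  have vP' c d : on_segment S c d (restr Pa u) v.
    by apply: trajectory_on_segment vP => //; have [] := uI c d.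
  rewrite (L2norm_ratio_le _ _ uU)//; apply/nsq_futureP.
    by move=> b; exact: integ_output (vP' 0 b).
  move=> L L0; apply: le_sqr_limit => //; first exact: ltW.
  move=> e e0.
  have vv0 : dot (v t) (v t) @[t --> -oo] --> (0 : R) by exact: cvg_dot0.
  (* The state reached by u differs from the one reached by its truncation to
     ]a, 0] by the free motion starting in v a, and v a tends to 0. *)
  have [a [a0 va]] : exists a, a <= 0 /\ k1 * dot (v a) (v a) <= e ^+ 2 * U.
    have k0 : 0 < e ^+ 2 * U / (k1 + 1).
      by rewrite divr_gt0 ?mulr_gt0 ?exprn_gt0// ltr_wpDl.
    have : \forall t \near -oo, t <= 0 /\ `|0 - dot (v t) (v t)| <= e ^+ 2 * U / (k1 + 1).
      near=> t; split; first by near: t; apply: nbhs_ninfty_le; rewrite num_real.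
      by near: t; move/cvgrPdist_le: vv0; apply.
    move=> /filter_ex[a [a0 Ha]]; exists a; split=> //.
    move: Ha; rewrite sub0r normrN ger0_norm ?dot_ge0// ler_pdivlMr ?ltr_wpDl//.
    by have := dot_ge0 (v a); nra.
  have uaL := L2fun_sub (mItv a) (@measurable_past R) (@subPast a) uL.
  have [Ua Ua0 uaU] := L2fun_nsq uaL.
  have UaU : Ua <= U.
    by rewrite -lee_fin -uaU -uU; apply: nsq_sub => //; exact: measurable_past.
  have uaI c d := L2fun_restr c d (mItv a) uaL.
  have [x [x0 xP]] := on_line_exists (a := a) (u := restr `]a, 0] u) Eu
    (fun b => let: And3 h _ _ := uaI a b in h)
    (fun t (ht : t <= a) => ltac:(by rewrite /restr memNset//= in_itv/= ltNge ht)).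
  have Hx := H a u x Ua a0 uaL uaU x0 xP L L0.
  have aL := le_trans a0 L0.
  pose w t := restr Pa u t - restr `]a, 0] u t.
  have wP : on_segment S a L w (fun t => v t - x t).
    exact: on_segmentB (vP' a L) (xP a L).
  have wE t : dot (w t) (w t) = dot (restr Pa u t) (restr Pa u t) -
      dot (restr `]a, 0] u t) (restr `]a, 0] u t).
    rewrite /w /restr; have [ta|ta] := boolP (t \in `]a, 0]%classic).
      have -> : t \in Pa by rewrite inE; apply: (@subPast a); rewrite -inE.
      by rewrite !subrr dot0l.
    by rewrite subr0 dot0l subr0.
  have wi : integ a L (fun t => dot (w t) (w t)).
    have [_ h1 _] := uI a L; have [_ h2 _] := uaI a L.
    by apply: integ_eq (integB h1 h2) => t _ _; rewrite wE.
  have w0 : int_ a L (fun t => dot (w t) (w t)) = 0.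
    rewrite (@int_obnd _ _ _ _ (fun=> 0)) ?int_cst ?mul0r//; first exact: integ_cst.
    move=> t at_ tL; rewrite wE /restr /Pa /past !mem_setE !in_itv/= at_/=.
    by rewrite subrr.
  have := K _ _ _ _ aL wi wP; rewrite w0 mulr0 addr0 (x0 a)// subr0 => He.
  have ei := integ_output Eu wP.
  have He' : int_ 0 L (fun t => dot (sysC S *m (v t - x t)) (sysC S *m (v t - x t))) <= e ^+ 2 * U.
    apply: le_trans (le_trans He va); apply: int_mono => //.
    by move=> t _ _; exact: dot_ge0.
  have Hx' : int_ 0 L (fun t => dot (sysC S *m x t) (sysC S *m x t)) <= eta ^+ 2 * U.
    by apply: (le_trans Hx); rewrite ler_wpM2l// sqr_ge0.
  have Ei t : sysC S *m x t + sysC S *m (v t - x t) = sysC S *m v t.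
    by rewrite -mulmxDr subrKC.
  have vi := integ_output Eu (vP' 0 L).
  have := int_minkowski eta0 (ltW e0) (ltW U0) (integ_output Eu (xP 0 L))
    (integ_sub a0 (lexx L) ei) _ Hx' He'.
  have -> : (fun t => dot (sysC S *m x t + sysC S *m (v t - x t))
    (sysC S *m x t + sysC S *m (v t - x t))) = (fun t => dot (sysC S *m v t) (sysC S *m v t)).
    by apply/funext => t; rewrite Ei.
  exact.
Unshelve. all: by end_near. Qed.

(** Makes both norms finite, without which their difference in the extended reals could not be
    controlled. *)
Lemma stable_gain : exists2 K : R, 0 <= K & hankel_gain K /\ future_gain K.
Proof.
have [k1 [k2 [k10 k20 K]]] := stable_output.
exists (Num.sqrt k2); first exact: sqrtr_ge0.
split=> [a w x U a0 wL wU x0 xP L L0|w x U wL wU x0 xP L L0]; rewrite sqr_sqrtr//.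
- have aL := le_trans a0 L0.
  have [_ wi2 wi3] := L2fun_restr a L (mItv a) wL.
  apply: (@le_trans _ _ (int_ a L (fun t => dot (sysC S *m x t) (sysC S *m x t)))).
    apply: int_mono => //; first exact: integ_output (xP _ _).
    by move=> t _ _; exact: dot_ge0.
  apply: (le_trans (K _ _ _ _ aL wi2 (xP _ _))).
  by rewrite x0// dot0l mulr0 add0r ler_wpM2l// -lee_fin (le_trans wi3)// wU.
- have [_ wi2 wi3] := future_int L wL.
  apply: (le_trans (K _ _ _ _ L0 wi2 (xP _))).
  by rewrite x0// dot0l mulr0 add0r ler_wpM2l// -lee_fin (le_trans wi3)// wU.
Qed.

End OneSystem.

(** * Comparison of the norms of two systems *)

Section TwoSystems.
Variables (nin p : nat).

(** The starting time is arbitrary: a = 0 serves the future gain, and a <= 0 with an input supported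
    in []a, 0]] serves the Hankel gain. *)
Definition output_gap N1 N2 (S1 : lti_system R N1 nin p) (S2 : lti_system R N2 nin p) (g : R) :=
  forall a b u x z, a <= b -> (forall t, vinteg a t u) ->
  integ a b (fun t => dot (u t) (u t)) -> x a = 0 -> z a = 0 ->
  on_segment S1 a b u x -> on_segment S2 a b u z ->
  int_ a b (fun t => dot (sysC S1 *m x t - sysC S2 *m z t) (sysC S1 *m x t - sysC S2 *m z t)) <=
  g ^+ 2 * int_ a b (fun t => dot (u t) (u t)).

Lemma output_gapC N1 N2 (S1 : lti_system R N1 nin p) (S2 : lti_system R N2 nin p) g :
  output_gap S1 S2 g -> output_gap S2 S1 g.
Proof.
move=> H a b u x z ab ui uu x0 z0 xP zP.
have := H a b u z x ab ui uu z0 x0 zP xP; apply: le_trans.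
rewrite le_eqVlt; apply/orP; left; apply/eqP/int_eq => t _ _.
by rewrite -opprB dotNl dotNr opprK.
Qed.

Section Transfer.
Variables (N1 N2 : nat) (S1 : lti_system R N1 nin p) (S2 : lti_system R N2 nin p).
Variable (g : R).
Hypotheses (E1 : sysE S1 \in unitmx) (E2 : sysE S2 \in unitmx) (g0 : 0 <= g).
Hypothesis gap : output_gap S1 S2 g.

(** The error is estimated from the common start [a] on, while outputs count only from [b] on; both
    uses take b = 0. Shrinking the segment only decreases the error, and Minkowski's inequality adds
    it to the gain of [S2]. *)
Let gap_add a b u x z L (eta U : R) : a <= b -> b <= L -> 0 <= eta -> 0 <= U ->
  (forall t, vinteg a t u) -> integ a L (fun t => dot (u t) (u t)) ->
  int_ a L (fun t => dot (u t) (u t)) <= U -> x a = 0 -> z a = 0 ->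
  on_segment S1 a L u x -> on_segment S2 a L u z ->
  int_ b L (fun t => dot (sysC S2 *m z t) (sysC S2 *m z t)) <= eta ^+ 2 * U ->
  int_ b L (fun t => dot (sysC S1 *m x t) (sysC S1 *m x t)) <= (eta + g) ^+ 2 * U.
Proof.
move=> ab bL eta0 U0 ui uu uU x0 z0 xP zP zb.
have aL := le_trans ab bL.
have eP := vprimB (vprimM (sysC S1) (on_segment_state E1 xP))
  (vprimM (sysC S2) (on_segment_state E2 zP)).
have ei := integ_dot eP eP.
have Eo : (fun t => dot (sysC S2 *m z t + (sysC S1 *m x t - sysC S2 *m z t))
   (sysC S2 *m z t + (sysC S1 *m x t - sysC S2 *m z t))) =
   (fun t => dot (sysC S1 *m x t) (sysC S1 *m x t)).
  by apply/funext => t; rewrite subrKC.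
have := int_minkowski eta0 g0 U0 (integ_sub ab (lexx L) (integ_output E2 zP))
  (integ_sub ab (lexx L) ei) _ zb.
rewrite Eo; apply; first exact: integ_sub ab (lexx L) (integ_output E1 xP).
apply: (@le_trans _ _ (g ^+ 2 * int_ a L (fun t => dot (u t) (u t)))); last first.
  by rewrite ler_wpM2l// sqr_ge0.
apply: le_trans (gap aL ui uu x0 z0 xP zP); apply: int_mono => //.
by move=> t _ _; exact: dot_ge0.
Qed.

Lemma hankel_gain_gap eta : 0 <= eta -> hankel_gain S2 eta -> hankel_gain S1 (eta + g).
Proof.
move=> eta0 H a w x U a0 wL wU x0 xP L L0.
have U0 : 0 <= U by rewrite -lee_fin -wU nsq_ge0.
have wI c d := L2fun_restr c d (mItv a) wL.
have [z [z0 zP]] := on_line_exists (a := a) (u := restr `]a, 0] w) E2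
    (fun b => let: And3 h _ _ := wI a b in h)
    (fun t (ht : t <= a) => ltac:(by rewrite /restr memNset//= in_itv/= ltNge ht)).
have [_ w2 w3] := wI a L.
apply: (gap_add a0 L0 eta0 U0 _ w2 _ (x0 a (lexx a)) (z0 a (lexx a)) (xP _ _) (zP _ _)).
- by move=> t; have [] := wI a t.
- by rewrite -lee_fin -wU.
- exact: (H _ _ _ _ a0 wL wU z0 zP _ L0).
Qed.

Lemma future_gain_gap eta : 0 <= eta -> future_gain S2 eta -> future_gain S1 (eta + g).
Proof.
move=> eta0 H w x U wL wU x0 xP L L0.
have U0 : 0 <= U by rewrite -lee_fin -wU nsq_ge0.
have wI b := future_int b wL.
have [z [z0 zP]] := on_segment_exists (a := 0) (u := w) E2
    (fun b => let: And3 h _ _ := wI b in h).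
have {}z0 := z0 0 (lexx 0).
have [_ w2 w3] := wI L.
apply: (gap_add (lexx 0) L0 eta0 U0 _ w2 _ x0 z0 (xP _) (zP _)).
- by move=> t; have [] := wI t.
- by rewrite -lee_fin -wU.
- exact: (H _ _ _ wL wU z0 zP _ L0).
Qed.

End Transfer.

(** [K1] and [K2] make both values real; each transfer is then applied with [eta] equal to the other
    value itself. *)
Lemma ereal_gap (h1 h2 : \bar R) (g K1 K2 : R) : (0 <= h1)%E -> (0 <= h2)%E ->
  (h1 <= K1%:E)%E -> (h2 <= K2%:E)%E ->
  (forall eta : R, 0 <= eta -> (h2 <= eta%:E)%E -> (h1 <= (eta + g)%:E)%E) ->
  (forall eta : R, 0 <= eta -> (h1 <= eta%:E)%E -> (h2 <= (eta + g)%:E)%E) ->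
  (`|h1 - h2| <= g%:E)%E.
Proof.
case: h1 => [h1| |] //; case: h2 => [h2| |]//; rewrite !lee_fin => h10 h20 _ _ H1 H2.
have := H1 h2 h20 (lexx _); have := H2 h1 h10 (lexx _).
by rewrite /= !lee_fin ler_norml => ? ?; apply/andP; split; lra.
Qed.

Theorem system_norms_gap N1 N2 (S1 : lti_system R N1 nin p) (S2 : lti_system R N2 nin p)
    (g : R) : (0 < nin)%N ->
  asymptotically_stable (sysE S1) (sysA S1) -> asymptotically_stable (sysE S2) (sysA S2) ->
  0 <= g -> output_gap S1 S2 g ->
  (`|hankel_norm S1 - hankel_norm S2| <= g%:E)%E /\
  (`|L2_system_norm S1 - L2_system_norm S2| <= g%:E)%E.
Proof.
move=> nin0 st1 st2 g0 gap; have [E1 _] := st1; have [E2 _] := st2.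
have [K1 K10 [HK1 FK1]] := stable_gain st1; have [K2 K20 [HK2 FK2]] := stable_gain st2.
have gap' := output_gapC gap.
split.
- apply: (@ereal_gap _ _ _ K1 K2); try exact: hankel_norm_ge0.
  + exact/hankel_normP.
  + exact/hankel_normP.
  + move=> eta eta0 /(hankel_normP st2 eta0) H; apply/hankel_normP; rewrite ?addr_ge0//.
    exact: hankel_gain_gap H.
  + move=> eta eta0 /(hankel_normP st1 eta0) H; apply/hankel_normP; rewrite ?addr_ge0//.
    exact: hankel_gain_gap H.
- apply: (@ereal_gap _ _ _ K1 K2); try exact: L2_system_norm_ge0.
  + exact/L2_system_normP.
  + exact/L2_system_normP.
  + move=> eta eta0 /(L2_system_normP st2 eta0) H; apply/L2_system_normP; rewrite ?addr_ge0//.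
    exact: future_gain_gap H.
  + move=> eta eta0 /(L2_system_normP st1 eta0) H; apply/L2_system_normP; rewrite ?addr_ge0//.
    exact: future_gain_gap H.
Qed.

End TwoSystems.

End Gains.

(** * Selected output rows and the truncation bound for norms *)

Lemma dot_rowsub_le (R : realType) n (J : {set 'I_n}) (x : 'cV[R]_n) :
  dot (rowsub (fun i : 'I_#|J| => enum_val i) x) (rowsub (fun i : 'I_#|J| => enum_val i) x)
  <= dot x x.
Proof.
rewrite !dotE (eq_bigr (fun i : 'I_#|J| => x (enum_val i) ord0 * x (enum_val i) ord0)).
  rewrite -(big_enum_val (fun i => x i ord0 * x i ord0)) [leRHS](bigID (mem J))/=.
  by rewrite lerDl sumr_ge0// => i _; rewrite -expr2 sqr_ge0.
by move=> i _; rewrite !mxE.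
Qed.

Lemma leading_gt0 (R : realType) N r (lerN : (r <= N)%N) (sigma : 'rV[R]_N) :
  (forall k, 0 <= sigma ord0 k) -> diag_mx (leading lerN sigma) \in unitmx ->
  forall i : 'I_N, (i < r)%N -> 0 < sigma ord0 i.
Proof.
move=> s0; rewrite unitmxE det_diag unitfE => /prodf_neq0 H i ir.
rewrite lt_def s0 andbT; have := H (Ordinal ir) isT.
by rewrite mxE (_ : widen_ord _ _ = i)//; exact: val_inj.
Qed.

Lemma bt_output_gap (R : realType) N nin p (S : lti_system R N nin p)
    (P Q LP LQ Ul Ur : 'M[R]_N) (sigma : 'rV[R]_N) (J : {set 'I_p}) r (lerN : (r <= N)%N) :
  sysE S \in unitmx -> gramians S P Q -> P = LP *m LP^T -> Q = LQ *m LQ^T ->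
  svd Ul sigma Ur (LQ^T *m sysE S *m LP) ->
  diag_mx (leading lerN sigma) \in unitmx ->
  output_gap (restrict_output J S)
    (project (bt_projection lerN LQ Ul sigma) (bt_projection lerN LP Ur sigma)
       (restrict_output J S))
    (2 * \sum_(k < N | (r <= k)%N) sigma ord0 k).
Proof.
move=> Eu [gP gQ] PE QE sv lead a b u x z ab ui uu x0 z0 xP zP.
have [_ _ s0 _ _] := sv; have sr := leading_gt0 s0 lead.
(* The reduced mass matrix is the identity, which puts the reduced equation into the explicit form
   of [balanced_truncation_bound]. *)
have mass := bt_mass sv lerN sr.
set Tl := bt_projection lerN LQ Ul sigma in zP mass *.
set Tr := bt_projection lerN LP Ur sigma in zP mass *.
have zP' : vprim a b z (fun t => Tl^T *m sysA S *m Tr *m z t + Tl^T *m sysB S *m u t).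
  by apply: vprim_eq zP => // t _ _; rewrite /= mass mul1mx.
have bound := balanced_truncation_bound Eu gP gQ PE QE sv sr ab ui uu x0 z0 xP zP'.
have E1 : sysE (restrict_output J S) \in unitmx by [].
have xP1 := on_segment_state E1 xP.
have ei k (M : 'M[R]_(k, N)) :
    integ a b (fun t => dot (M *m x t - M *m Tr *m z t) (M *m x t - M *m Tr *m z t)).
  have eP := vprimB (vprimM M xP1) (vprimM (M *m Tr) zP').
  exact: (integ_dot eP eP).
apply: le_trans bound; apply: int_le => [| |t _ _].
- exact: (ei _ (sysC (restrict_output J S))).
- exact: (ei _ (sysC S)).
- rewrite /= !mul_rowsub_mx.
  rewrite (_ : rowsub _ _ - rowsub _ _ = rowsub (fun i : 'I_#|J| => enum_val i)
    (sysC S *m x t - sysC S *m Tr *m z t)); first exact: dot_rowsub_le.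
  by apply/matrixP => k l; rewrite !mxE.
Qed.

(** The system-theoretic form of the estimate, for any set [J] of output rows. The right-hand side
    is independent of [J], and this is the uniformity in j once [J] is the set belonging to the j-th
    parameter. *)
Theorem bt_norms_gap (R : realType) N nin p (S : lti_system R N nin p)
    (P Q LP LQ Ul Ur : 'M[R]_N) (sigma : 'rV[R]_N) (J : {set 'I_p}) r (lerN : (r <= N)%N)
    (Tl := bt_projection lerN LQ Ul sigma) (Tr := bt_projection lerN LP Ur sigma)
    (SJ := restrict_output J S) :
  (0 < nin)%N -> asymptotically_stable (sysE S) (sysA S) ->
  gramians S P Q -> P = LP *m LP^T -> Q = LQ *m LQ^T ->
  svd Ul sigma Ur (LQ^T *m sysE S *m LP) ->
  diag_mx (leading lerN sigma) \in unitmx ->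
  asymptotically_stable (Tl^T *m sysE S *m Tr) (Tl^T *m sysA S *m Tr) ->
  (maxe `|hankel_norm SJ - hankel_norm (project Tl Tr SJ)|
        `|L2_system_norm SJ - L2_system_norm (project Tl Tr SJ)|
   <= (2 * \sum_(k < N | (r <= k)%N) sigma ord0 k)%:E)%E.
Proof.
move=> nin0 st gram PE QE sv lead st'.
have [Eu _] := st; have [_ _ s0 _ _] := sv.
have gap : output_gap SJ (project Tl Tr SJ) (2 * \sum_(k < N | (r <= k)%N) sigma ord0 k).
  exact: bt_output_gap Eu gram PE QE sv lead.
have g0 : 0 <= 2 * \sum_(k < N | (r <= k)%N) sigma ord0 k by rewrite mulr_ge0// sumr_ge0.
have [H1 H2] := system_norms_gap nin0 (st : asymptotically_stable (sysE SJ) (sysA SJ))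
  (st' : asymptotically_stable (sysE (project Tl Tr SJ)) (sysA (project Tl Tr SJ))) g0 gap.
by rewrite ge_max H1 H2.
Qed.

Theorem theorem2 (R : realType) (q n nin : nat) (nin_gt0 : (0 < nin)%N)
  (Pi : set 'rV[R]_q) (rho : 'rV[R]_q -> R)
  (density : joint_density Pi rho)
  (independence : independent_parameters Pi rho)
  (E A : 'rV[R]_q -> 'M[R]_n)
  (B : 'rV[R]_q -> 'M[R]_(n, nin)) (C : 'rV[R]_q -> 'rV[R]_n)
  (contE : {within Pi, continuous E}) (contA : {within Pi, continuous A})
  (contB : {within Pi, continuous B}) (contC : {within Pi, continuous C})
  (stable : forall p, Pi p -> asymptotically_stable (E p) (A p))
  (Phi : nat -> mpoly.mpoly q R) (basis : polynomial_basis Pi rho Phi)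
  (d m : nat) (index_set : forall i, (degree (Phi i) <= d)%N = (i < m)%N) :
  let Sigma := galerkin Pi rho E A B C Phi m in
  asymptotically_stable (sysE Sigma) (sysA Sigma) ->
  forall P Q LP LQ Ul Ur : 'M[R]_(m * n), forall sigma : 'rV[R]_(m * n),
  gramians Sigma P Q ->
  P = LP *m LP^T -> Q = LQ *m LQ^T ->
  svd Ul sigma Ur (LQ^T *m sysE Sigma *m LP) ->
  forall (r : nat) (ltrN : (r < m * n)%N),
  diag_mx (leading (ltnW ltrN) sigma) \in unitmx ->
  let Tl := bt_projection (ltnW ltrN) LQ Ul sigma in
  let Tr := bt_projection (ltnW ltrN) LP Ur sigma in
  asymptotically_stable (Tl^T *m sysE Sigma *m Tr) (Tl^T *m sysA Sigma *m Tr) ->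
  forall j : 'I_q,
  let Sigmaj := restrict_output (sensitivity_set Phi m j) Sigma in
  let redSigmaj := project Tl Tr Sigmaj in
  (maxe `|hankel_norm Sigmaj - hankel_norm redSigmaj|
        `|L2_system_norm Sigmaj - L2_system_norm redSigmaj|
   <= (2 * \sum_(k < (m * n)%N | (r <= k)%N) sigma ord0 k)%:E)%E.
Proof.
move=> Sigma st P Q LP LQ Ul Ur sigma gram PE QE sv r ltrN lead Tl Tr st' j.
exact: (bt_norms_gap _ nin_gt0 st gram PE QE sv lead st').
Qed.
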